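(* Let $r_k\ge0$. Under the LoS-only interference model, the Laplace transform $\mathcal L_{I_k}(s)=\mathbb E[e^{-sI_k}]$ of the aggregate interference $I_k$ at the $k$th nearest vehicle, located at $\mathbf x_k$ at distance $r_k$ from its serving UAV, is, for $s\ge0$, $$\mathcal L_{I_k}(s)=\exp\!\left(-\gamma\lambda_u p_{\mathrm a}\int_{r_k}^{\infty}\frac{sP_{\mathrm t}G_{\mathrm c}\,d(x)^{-\alpha}e^{-\kappa_f d(x)}}{1+sP_{\mathrm t}G_{\mathrm c}\,d(x)^{-\alpha}e^{-\kappa_f d(x)}}\;p_{\mathsf L}(x,H)\,x\,dx\right),\qquad d(x)=\sqrt{x^2+H^2}.$$
   Context: Constants: UAV altitude $H>0$, UAV density $\lambda_u>0$, UAV activation probability $p_{\mathrm a}\in[0,1]$ (probability that a UAV senses at least one vehicle during its full scan), beamwidth $\gamma\in(0,2\pi]$, transmit power $P_{\mathrm t}>0$, main-lobe communication gain $G_{\mathrm c}>0$, path-loss exponent $\alpha>0$, absorption coefficient $\kappa_f>0$, blockage parameters $a,b>0$. The line-of-sight (LoS) probability is $$p_{\mathsf L}(r,H)=\frac{1}{1+a\exp\!\left(-b\left[\frac{180}{\pi}\arctan(H/r)-a\right]\right)}$$ (with $\arctan(H/0)=\pi/2$). Model: the active UAVs' ground projections $\Phi_u^{\mathrm a}$ form a homogeneous Poisson point process on $\mathbb R^2$ of intensity $\lambda_u p_{\mathrm a}$ (independent $p_{\mathrm a}$-thinning of a homogeneous Poisson process of intensity $\lambda_u$). The interference at the vehicle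 at $\mathbf x_k$ is $$I_k=\sum_{\mathbf y\in\Phi_u^{\mathrm a}\setminus b_2(\mathbf x_k,r_k)}P_{\mathrm t}\,G_{\mathbf y}\,h_{\mathbf y}\,d(\|\mathbf y-\mathbf x_k\|)^{-\alpha}e^{-\kappa_f d(\|\mathbf y-\mathbf x_k\|)}\,\mathbb 1_{\mathbf y}(\mathrm{LoS}),$$ where $b_2(\mathbf x_k,r_k)$ is the disk of radius $r_k$ centred at $\mathbf x_k$. The $h_{\mathbf y}$ are i.i.d. exponential with mean 1 (Rayleigh fading). $\mathbb 1_{\mathbf y}(\mathrm{LoS})$ are independent Bernoulli variables with success probability $p_{\mathsf L}(\|\mathbf y-\mathbf x_k\|,H)$. The gain is $G_{\mathbf y}=G_{\mathrm c}$ if the beam of UAV $\mathbf y$ (with orientation $\Theta_{\mathbf y}$, i.i.d. uniform on $[0,2\pi)$) covers the vehicle, i.e. $|\theta_{\mathbf y}-\Theta_{\mathbf y}|\le\gamma/2$ modulo $2\pi$ with $\theta_{\mathbf y}$ the direction of the vehicle seen from $\mathbf y$, and $G_{\mathbf y}=0$ otherwise; so $G_{\mathbf y}=G_{\mathrm c}$ with probability $\gamma/(2\pi)$. Fading, LoS states, beam orientations and the point process are mutually independent. *)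

(* Defs.v *)
From HB Require Import structures.
From mathcomp Require Import all_boot all_order all_algebra.
From mathcomp Require Import all_classical all_reals all_analysis measurable_realfun.

Set Implicit Arguments.
Unset Strict Implicit.
Unset Printing Implicit Defensive.

Import Order.TTheory GRing.Theory Num.Theory.
Import numFieldNormedType.Exports.

Local Open Scope classical_set_scope.
Local Open Scope ring_scope.

Section geometry.
Context {R : realType}.
Implicit Types (x y : R * R).

(* The norm that the library puts on [R * R] is the sup norm. *)
Definition dist2 x y : R :=
  Num.sqrt ((x.1 - y.1) ^+ 2 + (x.2 - y.2) ^+ 2).

Definition disk x (r : R) : set (R * R) := [set y | dist2 y x <= r].

(* [theta] is a polar angle of [x - y]; it is determined modulo [2 * pi] when
   [x != y]. *)
Definition is_direction y x (theta : R) : Prop :=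
  x.1 - y.1 = dist2 x y * cos theta /\ x.2 - y.2 = dist2 x y * sin theta.

(* As [theta] ranges over all the determinations of the direction of [x] seen
   from [y], the inequality is to be understood modulo [2 * pi]. *)
Definition beam_covers (gamma Theta : R) y x : Prop :=
  exists theta, is_direction y x theta /\ `|theta - Theta| <= gamma / 2.

Definition link_distance (H r : R) : R := Num.sqrt (r ^+ 2 + H ^+ 2).

(* [H / 0 = 0] in the library, whereas arctan (H / 0) has to be pi / 2. *)
Definition elevation (H r : R) : R := if r == 0 then pi / 2 else atan (H / r).

Definition los_prob (a b r H : R) : R :=
  (1 + a * expR (- (b * (180 / pi * elevation H r - a))))^-1.

Lemma two_pi_gt0 : 0 < 2 * pi :> R.
Proof. by rewrite mulr_gt0// pi_gt0. Qed.

End geometry.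

Section probability.
Context {d : measure_display} {T : measurableType d} {R : realType}.
Variable P : probability T R.
Local Open Scope ereal_scope.

Definition mutually_independent (I : eqType) (F : I -> set_system T) : Prop :=
  forall (J : seq I) (E : I -> set T), uniq J ->
    (forall i, i \in J -> F i (E i)) ->
    P (\big[setI/setT]_(i <- J) E i) = \prod_(i <- J) P (E i).

Definition generated_by {d'} {T' : measurableType d'} (X : T -> T') :
    set_system T :=
  preimage_set_system setT X measurable.

Definition has_law {d'} {T' : measurableType d'} (X : {mfun T >-> T'})
    (mu : set T' -> \bar R) : Prop :=
  forall B, measurable B -> distribution P X B = mu B.

Definition point_count (X : nat -> T -> R * R) (B : set (R * R)) (w : T) :
    \bar R :=
  \sum_(n <oo) \d_(X n w) B.

Definition area : set (R * R) -> \bar R :=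
  (@lebesgue_measure R \x @lebesgue_measure R).

(* The points are listed by a sequence, which is no restriction since a
   homogeneous Poisson process of positive intensity has almost surely
   infinitely many points.  The Poisson weights are written out because
   [poisson_pmf 0 k = 1] for every [k]. *)
Definition homogeneous_poisson_process (intensity : R)
    (X : nat -> {mfun T >-> (R * R)%type}) : Prop :=
  (forall (B : set (R * R)) (k : nat), measurable B -> area B < +oo ->
     let m := (intensity * fine (area B))%R in
     P [set w | point_count X B w = k%:R%:E]
       = (m ^+ k / k`!%:R * expR (- m))%:E) /\
  (forall (N : nat) (B : 'I_N -> set (R * R)),
     (forall i, measurable (B i) /\ area (B i) < +oo) ->
     trivIset setT B ->
     mutually_independent
       (fun i => generated_by (point_count X (B i)))).

(* Given the sigma-algebra [G], the events [L j] are independent and [L j] has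
   conditional probability [p j]. *)
Definition conditionally_bernoulli (G : set_system T) (L : nat -> set T)
    (p : nat -> T -> R) : Prop :=
  forall (J : seq nat) (E : set T), uniq J -> G E ->
    P (E `&` \big[setI/setT]_(j <- J) L j)
      = \int[P]_(w in E) (\prod_(j <- J) p j w)%:E.

End probability.

Variant source :=
  Positions | Activation of nat | Fading of nat | Orientation of nat.

HB.instance Definition _ := gen_eqMixin source.

Section model.
Context {d : measure_display} {T : measurableType d} {R : realType}.
Variables (X : nat -> {mfun T >-> (R * R)%type}) (A : nat -> set T)
  (h Theta : nat -> {mfun T >-> R}).

(* The points [X n] are the ground projections of all the UAVs, and the n-th
   UAV is active on [A n].  The line-of-sight states are not among the sources:
   their law depends on the positions, see [conditionally_bernoulli]. *)
Definition source_events (s : source) : set_system T :=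
  match s with
  | Positions => <<s \bigcup_n generated_by (X n) >>
  | Activation n => <<s [set A n] >>
  | Fading n => generated_by (h n)
  | Orientation n => generated_by (Theta n)
  end.

Definition all_source_events : set_system T :=
  <<s \bigcup_s source_events s >>.

Variables (H Pt Gc gamma alpha kappa : R) (L : nat -> set T).

Definition gain (x : R * R) (n : nat) (w : T) : R :=
  if `[< beam_covers gamma (Theta n w) (X n w) x >] then Gc else 0.

Definition received_power (x : R * R) (n : nat) (w : T) : R :=
  let dn := link_distance H (dist2 (X n w) x) in
  Pt * gain x n w * h n w * dn `^ (- alpha) * expR (- (kappa * dn))
    * \1_(L n) w.

Definition interference (x : R * R) (r : R) (w : T) : \bar R :=
  \esum_(n in [set n | A n w /\ (~` disk x r) (X n w)])
    (received_power x n w)%:E.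

End model.

(* [I] is extended-real-valued because an infinite sum of received powers may
   diverge on a negligible event, where [exp (- s I)] is then 0 for [s > 0]
   and 1 for [s = 0]. *)
Definition laplace_transform {d} {T : measurableType d} {R : realType}
    (P : probability T R) (I : T -> \bar R) (s : R) : \bar R :=
  (\int[P]_w expeR (- (s%:E * I w)))%E.

(* Main.v *)
Require Import Defs.
From HB Require Import structures.
From mathcomp Require Import all_boot all_order all_algebra.
From mathcomp Require Import all_classical all_reals all_analysis measurable_realfun.
From mathcomp Require Import ring lra.

(* Expanding the product of the factors [1 - V n], where [1 - V n] is the
   contribution of the n-th UAV to [exp (- s I)], reduces the expectation of a
   finite product to expectations of products of the [V n].  There the
   line-of-sight indicators are replaced by their conditional probabilities
   and, with the positions frozen, activation, fading and orientation integrate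
   out independently of each other: [V n] becomes a function [v] of the position
   of the n-th UAV.  In the limit, [L(s)] is the expectation of the product of
   the [1 - v (X n)], which the Laplace functional of the Poisson process
   evaluates to [exp (- lambda * int v)].  That functional follows from the
   Poisson law of the counts for simple functions, then by monotone limits.
   Finally [v] is radial, and the area of disks turns its integral over the plane
   into the integral of [2 * pi * r * v r]. *)

Set Implicit Arguments.
Unset Strict Implicit.
Unset Printing Implicit Defensive.

Import Order.TTheory GRing.Theory Num.Theory.
Import numFieldNormedType.Exports.

Local Open Scope classical_set_scope.
Local Open Scope ring_scope.

(** * Measures with a density *)

(** The hypothesis on the line-of-sight states evaluates only intersections of the events [L j] and
    says nothing directly about complements; this is why the computation goes through monomials in
    the [V n]. The factor of one UAV is exactly [1 - V n] because its exponent is a 0-1 variable [e]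
    times a number [x], and then [exp (- (e * x)) = 1 - e * (1 - exp (- x))]. Activation is treated
    as one more 0-1 mark, so no separate thinning argument occurs: [p_a] enters through [v].
    Rayleigh fading contributes [1 - E (exp (- (q * h))) = q / (1 + q)], which is strictly below 1.
    Hence [v < 1], and the test function [- ln (1 - v)] given to the Laplace functional is finite
    everywhere. The constant [gamma * lambda_u * p_a] is what remains of
    [lambda_u * p_a * (gamma / (2 * pi))] once the perimeter of the circles has contributed its
    factor [2 * pi]. *)

Section density.
Context d1 d2 (T1 : measurableType d1) (T2 : measurableType d2) (R : realType).
Variables (mu : {measure set T1 -> \bar R}) (nu : {measure set T2 -> \bar R}).
Variables (Y : T1 -> T2) (g : T1 -> R).
Hypotheses (mY : measurable_fun setT Y) (mg : measurable_fun setT g).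
Hypothesis g0 : forall x, 0 <= g x.
Hypothesis nuE : forall B, measurable B ->
  nu B = (\int[mu]_(x in Y @^-1` B) (g x)%:E)%E.
Local Open Scope ereal_scope.
Import HBNNSimple.

Let indicD B : measurable B ->
  \int[nu]_y (\1_B y)%:E = \int[mu]_x ((\1_B (Y x))%:E * (g x)%:E).
Proof.
move=> mB; rewrite integral_indic// setIT nuE// integral_mkcond.
apply: eq_integral => x _; rewrite patchE indicE.
have -> : (x \in Y @^-1` B) = (Y x \in B) by apply/idP/idP; rewrite !inE.
by case: ifPn => _; rewrite ?mul1e ?mul0e.
Qed.

Let nnsfunD (f : {nnsfun T2 >-> R}) :
  \int[nu]_y (f y)%:E = \int[mu]_x ((f (Y x))%:E * (g x)%:E).
Proof.
under eq_integral do rewrite fimfunE -fsumEFin//.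
rewrite ge0_integral_fsum//; last 2 first.
- by move=> r; exact/measurable_EFinP/measurable_funM.
- by move=> r y _; rewrite EFinM nnfun_muleindic_ge0.
transitivity (\int[mu]_x (\sum_(r \in range f)
    ((r * \1_(f @^-1` [set r]) (Y x))%:E * (g x)%:E))); last first.
  apply: eq_integral => x _; rewrite [in RHS]fimfunE -fsumEFin// muleC.
  rewrite ge0_mule_fsumr//; last by move=> r; rewrite EFinM nnfun_muleindic_ge0.
  by apply: eq_fsbigr => r _; rewrite muleC.
have m1 (r : R) : measurable_fun [set: T1]
    (fun x => (\1_(f @^-1` [set r]) (Y x))%:E * (g x)%:E).
  apply: emeasurable_funM; apply/measurable_EFinP => //.
  by apply: (measurableT_comp _ mY); exact: measurable_indic.
rewrite ge0_integral_fsum//; last 2 first.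
- move=> r; under eq_fun do rewrite EFinM -muleA.
  by apply: emeasurable_funM.
- by move=> r x _; rewrite mule_ge0 ?lee_fin// -lee_fin EFinM nnfun_muleindic_ge0.
apply: eq_fsbigr => r; rewrite inE => -[y _ <-].
under eq_integral do rewrite EFinM.
rewrite ge0_integralZl//; last 2 first.
- exact/measurable_EFinP.
- by rewrite lee_fin.
under [RHS]eq_integral do rewrite EFinM -muleA.
rewrite ge0_integralZl//; last 2 first.
- by move=> x _; rewrite mule_ge0// lee_fin.
- by rewrite lee_fin.
by rewrite indicD.
Qed.

(** The map [Y] between two measurable spaces lets [Y := id] go from a sigma-algebra to a coarser
    one, which is how conditional probabilities are handled below. The exponential law and the law
    of the distance are the cases with one space. *)
Lemma ge0_integral_density (f : T2 -> \bar R) :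
  measurable_fun setT f -> (forall y, 0 <= f y) ->
  \int[nu]_y f y = \int[mu]_x (f (Y x) * (g x)%:E).
Proof.
move=> mf f0; pose f_ := nnsfun_approx measurableT mf.
have cf y : (f_ n y)%:E @[n --> \oo] --> f y by exact: cvg_nnsfun_approx.
have ndf y : {homo (fun n => (f_ n y)%:E) : m n / (m <= n)%N >-> m <= n}.
  by move=> m n mn; rewrite lee_fin; exact/lefP/nd_nnsfun_approx.
transitivity (limn (fun n => \int[nu]_y (f_ n y)%:E)).
  rewrite -monotone_convergence//.
  - by apply: eq_integral => y _; apply/esym/cvg_lim.
  - by move=> n; exact/measurable_EFinP.
  - by move=> n y _; rewrite lee_fin.
transitivity (limn (fun n => \int[mu]_x ((f_ n (Y x))%:E * (g x)%:E))).
  by apply/congr_lim/funext => n; rewrite nnsfunD.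
rewrite -monotone_convergence//.
- apply: eq_integral => x _; apply/cvg_lim => //.
  by apply: cvgeZr.
- move=> n; apply: emeasurable_funM => //; apply/measurable_EFinP => //.
  exact: measurableT_comp.
- by move=> n x _; rewrite mule_ge0// lee_fin.
- by move=> x _ m n mn; rewrite lee_wpmul2r ?lee_fin//; exact: ndf.
Qed.

End density.

Section density_measure.
Context d (T : measurableType d) (R : realType) (mu : {measure set T -> \bar R}).
Local Open Scope ereal_scope.

Lemma density_measure_exists (g : T -> R) : measurable_fun setT g ->
  (forall x, (0 <= g x)%R) ->
  exists nu : {measure set T -> \bar R},
    forall B, nu B = \int[mu]_(x in B) (g x)%:E.
Proof.
move=> mg g0; pose nu (B : set T) := \int[mu]_(x in B) (g x)%:E.
have nu0 : nu set0 = 0 by rewrite /nu integral_set0.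
have nu_ge0 B : 0 <= nu B by apply: integral_ge0 => x _; rewrite lee_fin.
have nu_sigma : semi_sigma_additive nu.
  move=> F mF tF mUF; rewrite /nu; apply: cvg_toP.
    apply: ereal_nondecreasing_is_cvgn => m n mn.
    by apply: lee_sum_nneg_natr => // k _ _; exact: nu_ge0.
  rewrite ge0_integral_bigcup//=.
  - exact/measurable_EFinP/measurable_funTS.
  - by move=> x _; rewrite lee_fin.
pose mnu := isMeasure.Build _ _ _ nu nu0 nu_ge0 nu_sigma.
pose nuM : {measure set T -> \bar R} := HB.pack nu mnu.
by exists nuM.
Qed.

End density_measure.

(** * Independence *)

Section freezing.
Context d (T : measurableType d) (R : realType) (P : probability T R).
Context d1 d2 (T1 : measurableType d1) (T2 : measurableType d2).
Variables (Y1 : T -> T1) (Y2 : T -> T2).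
Hypotheses (mY1 : measurable_fun setT Y1) (mY2 : measurable_fun setT Y2).
Local Open Scope ereal_scope.
Hypothesis indep : forall A B, measurable A -> measurable B ->
  P (Y1 @^-1` A `&` Y2 @^-1` B) = P (Y1 @^-1` A) * P (Y2 @^-1` B).

HB.instance Definition _ := isMeasurableFun.Build _ _ _ _ Y1 mY1.
HB.instance Definition _ := isMeasurableFun.Build _ _ _ _ Y2 mY2.

(** Independence makes the joint law the product of the two laws, and Tonelli's theorem applies to
    that product. *)
Lemma integral_independent_pair (f : T1 * T2 -> \bar R) :
  measurable_fun setT f -> (forall z, 0 <= f z) ->
  \int[P]_w f (Y1 w, Y2 w) = \int[P]_w \int[P]_w' f (Y1 w, Y2 w').
Proof.
move=> mf f0.
pose Y w := (Y1 w, Y2 w).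
have mY : measurable_fun setT Y by exact: measurable_fun_pair.
pose hY := isMeasurableFun.Build _ _ _ _ Y mY.
pose Y' : {mfun T >-> (T1 * T2)%type} := HB.pack Y hY.
have E : forall A, measurable A ->
    (distribution P Y1 \x distribution P Y2) A = distribution P Y' A.
  apply: product_measure_unique => A B mA mB.
  by rewrite /distribution/= /pushforward/= -indep.
transitivity (\int[distribution P Y']_z f z).
  by rewrite ge0_integral_pushforward//=.
rewrite (eq_measure_integral (distribution P Y1 \x distribution P Y2)); last first.
  by move=> A mA _; rewrite /= -E.
rewrite fubini_tonelli1// ge0_integral_pushforward//=; last 2 first.
- exact: measurable_fun_fubini_tonelli_F.
- by move=> x _; apply: integral_ge0.
apply: eq_integral => w _ /=; rewrite /fubini_F ge0_integral_pushforward//=.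
exact: measurableT_comp.
Qed.

End freezing.

Lemma bigsetI_seqP (I : eqType) (U : Type) (s : seq I) (F : I -> set U) (w : U) :
  (\big[setI/setT]_(j <- s) F j) w <-> (forall j, j \in s -> F j w).
Proof.
elim: s => [|i s IHs]; first by rewrite big_nil.
rewrite big_cons; split=> [[Fi /IHs Fs] j|Fs].
  by rewrite inE => /predU1P[->//|]; exact: Fs.
split; first by apply: Fs; rewrite inE eqxx.
by apply/IHs => j js; apply: Fs; rewrite inE js orbT.
Qed.

Section grouping.
Context d (T : measurableType d) (R : realType) (P : probability T R).
Local Open Scope ereal_scope.

(** Both sides are finite measures in [A] that agree on the pi-system [C], hence on the
    sigma-algebra that it generates. *)
Lemma independent_g_sigma_algebra (C : set_system T) (E : set T) :
  C `<=` measurable -> setI_closed C -> C setT -> measurable E ->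
  (forall A, C A -> P (E `&` A) = P E * P A) ->
  forall A, <<s C >> A -> P (E `&` A) = P E * P A.
Proof.
move=> Cm CI CT mE CE A CA.
have [r rE] : exists r : {nonneg R}, P E = r%:num%:E.
  have PE0 : (0 <= fine (P E))%R by rewrite fine_ge0.
  by exists (NngNum PE0); rewrite /= fineK// fin_num_measure.
have : mrestr P mE A = mscale r P A.
  apply: (@g_sigma_algebra_measure_unique _ R T C Cm (fun=> setT)) => //.
  - by rewrite bigcup_const.
  - by move=> B CB; rewrite /= /mrestr /mscale/= -rE setIC CE.
  - by move=> _; rewrite /= /mrestr setTI (le_lt_trans (probability_le1 _ _)) ?ltry.
by rewrite /mrestr /mscale -rE setIC.
Qed.

Variables (I : eqType) (F : I -> set_system T).
Hypotheses (Fm : forall i, F i `<=` measurable).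
Hypotheses (Fs : forall i, sigma_algebra setT (F i)).
Hypothesis indep : mutually_independent P F.

Lemma mutually_independent_others (i0 : I) (E A : set T) : F i0 E ->
  <<s \bigcup_(i in [set i | i != i0]) F i >> A -> P (E `&` A) = P E * P A.
Proof.
move=> FE.
have FT i : F i setT.
  by have [F0 FC _] := Fs i; rewrite -(setD0 setT); exact: FC.
have FI i : setI_closed (F i).
  move=> B B' FB FB'; have FsE := sigma_algebra_id (Fs i).
  rewrite -FsE in FB FB' *.
  exact: (@measurableI _ (g_sigma_algebraType (F i))).
(* The union of the [F i] is not stable under intersection; the finite intersections of events from
   indices other than [i0] form a pi-system that contains it. *)
pose C := [set B | exists J (D : I -> set T), [/\ uniq J, i0 \notin J,
  forall j, j \in J -> F j (D j) & B = \big[setI/setT]_(j <- J) D j]].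
have Cm : C `<=` measurable.
  move=> _ [J [D [_ _ FD ->]]]; rewrite big_seq.
  by apply: bigsetI_measurable => j /FD; exact: Fm.
have CI : setI_closed C.
  move=> _ _ [J [D [uJ i0J FD ->]]] [J' [D' [uJ' i0J' FD' ->]]].
  (* An index present in only one of the two lists gets [setT] from the other. *)
  pose patch (J : seq I) (D : I -> set T) j := if j \in J then D j else setT.
  exists (undup (J ++ J')), (fun j => patch J D j `&` patch J' D' j); split.
  - exact: undup_uniq.
  - by rewrite mem_undup mem_cat negb_or i0J.
  - by move=> j _; apply: FI; rewrite /patch; case: ifPn => //; [exact: FD|exact: FD'].
  - apply/seteqP; split=> [w [/bigsetI_seqP JD /bigsetI_seqP JD']|w /bigsetI_seqP JD].
      apply/bigsetI_seqP => j _.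
      by split; rewrite /patch; case: ifPn => // jJ; [exact: JD|exact: JD'].
    split; apply/bigsetI_seqP => j jJ;
      have := JD j; rewrite mem_undup mem_cat jJ ?orbT => /(_ erefl)[];
      by rewrite /patch jJ.
move=> CA; apply: (independent_g_sigma_algebra Cm CI) => //.
- by exists [::], (fun=> setT); split => //; rewrite big_nil.
- exact: Fm FE.
- move=> _ [J [D [uJ i0J FD ->]]].
  (* Independence is applied to [i0 :: J] and to [J]; comparing the two products isolates the factor
     [P E]. *)
  pose D' j := if j == i0 then E else D j.
  have eD : \big[setI/setT]_(j <- J) D' j = \big[setI/setT]_(j <- J) D j.
    by apply: eq_big_seq => j jJ; rewrite /D'; case: eqP => // ji0; rewrite -ji0 jJ in i0J.
  have eP : \prod_(j <- J) P (D' j) = \prod_(j <- J) P (D j).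
    by apply: eq_big_seq => j jJ; rewrite /D'; case: eqP => // ji0; rewrite -ji0 jJ in i0J.
  have FD' J' : {subset J' <= i0 :: J} -> forall j, j \in J' -> F j (D' j).
    move=> sJ j /sJ; rewrite inE /D'; case: eqP => [-> //|_ /=]; exact: FD.
  have := @indep (i0 :: J) D'.
  have D'0 : D' i0 = E by rewrite /D' eqxx.
  rewrite !big_cons eD eP D'0 /= i0J uJ => -> //; last exact: (FD' _ (i0 :: J)).
  rewrite -eP -eD (@indep J D') //.
  by apply: FD' => j jJ; rewrite inE jJ orbT.
- apply: sub_sigma_algebra2 CA => B [i /= ii0 FB].
  exists [:: i], (fun=> B); split => //.
  - by rewrite inE eq_sym.
  - by move=> j; rewrite inE => /eqP ->.
  - by rewrite big_seq1.
Qed.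

End grouping.

Section sub_sigma_algebra.
Context d d' (T : measurableType d) (T' : measurableType d').

Lemma measurable_fun_sub_sigma_algebra (C D : set_system T) (f : T -> T') :
  C `<=` <<s D >> ->
  measurable_fun setT (f : g_sigma_algebraType C -> T') ->
  measurable_fun setT (f : g_sigma_algebraType D -> T').
Proof.
move=> CD mf _ B mB; have /= := mf measurableT B mB.
by apply: smallest_sub => //; exact: smallest_sigma_algebra.
Qed.

Lemma measurable_fun_from_sub_sigma_algebra (C : set_system T) (f : T -> T') :
  C `<=` measurable ->
  measurable_fun setT (f : g_sigma_algebraType C -> T') ->
  measurable_fun setT f.
Proof.
move=> Cm mf _ B mB; have /= := mf measurableT B mB.
by apply: smallest_sub => //; exact: sigma_algebra_measurable.
Qed.

Lemma measurable_fun_generated_by (C : set_system T) (f : T -> T') :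
  generated_by f `<=` <<s C >> ->
  measurable_fun setT (f : g_sigma_algebraType C -> T').
Proof. by move=> fC _ B mB; apply: fC; exists B. Qed.

End sub_sigma_algebra.

Section independent_product.
Context d (T : measurableType d) (R : realType) (P : probability T R).
Variables (I : eqType) (F : I -> set_system T).
Hypotheses (Fm : forall i, F i `<=` measurable).
Hypotheses (Fs : forall i, sigma_algebra setT (F i)).
Hypothesis indep : mutually_independent P F.
Local Open Scope ereal_scope.

Local Notation others i0 := (\bigcup_(i in [set i | i != i0]) F i).

(** The two independent random elements are both the identity of [T], seen through [F i0] and
    through the sigma-algebra of the other indices. The outcome can thus be split into [w] and [w']
    without naming the variables involved. *)
Lemma integral_independent_others (i0 : I) (f : T -> T -> \bar R) :
  measurable_fun setT
    (fun z : g_sigma_algebraType (F i0) * g_sigma_algebraType (others i0) =>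
       f z.1 z.2) ->
  (forall w w', 0 <= f w w') ->
  \int[P]_w f w w = \int[P]_w \int[P]_w' f w w'.
Proof.
move=> mf f0.
have mid (C : set_system T) : C `<=` measurable ->
    measurable_fun setT (id : T -> g_sigma_algebraType C).
  move=> Cm _ B; rewrite setTI preimage_id => mB.
  by apply: (smallest_sub _ Cm) mB; exact: sigma_algebra_measurable.
have om : others i0 `<=` measurable by move=> B [i _ /Fm].
apply: (integral_independent_pair (mid _ (@Fm i0)) (mid _ om) _ mf) => //.
move=> A B mA mB; rewrite !preimage_id.
apply: (mutually_independent_others Fm Fs indep _ mB).
by rewrite -(sigma_algebra_id (Fs i0)).
Qed.

Lemma integral_prod_independent (J : seq I) (Y : I -> T -> R) : uniq J ->
  (forall i, measurable_fun setT (Y i : g_sigma_algebraType (F i) -> R)) ->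
  (forall i w, (0 <= Y i w)%R) ->
  \int[P]_w (\prod_(i <- J) Y i w)%:E = \prod_(i <- J) \int[P]_w (Y i w)%:E.
Proof.
move=> + mY Y0; elim: J => [_|i J IHJ /= /andP[iJ uJ]].
  under eq_integral do rewrite big_nil.
  by rewrite big_nil integral_cst//= mul1e probability_setT.
under eq_integral do rewrite big_cons.
rewrite big_cons -IHJ//.
have prod0 w : (0 <= \prod_(i <- J) Y i w)%R by apply: prodr_ge0.
rewrite (@integral_independent_others i
  (fun w w' => (Y i w * \prod_(i <- J) Y i w')%:E)).
- have mYi : measurable_fun setT (Y i).
    exact: measurable_fun_from_sub_sigma_algebra (mY i).
  have mP : measurable_fun setT (fun w => \prod_(i <- J) Y i w)%R.
    apply: measurable_prod => j _.
    exact: measurable_fun_from_sub_sigma_algebra (mY j).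
  under eq_integral => w _.
    under eq_integral do rewrite EFinM.
    rewrite ge0_integralZl//; last 3 first.
    - exact/measurable_EFinP.
    - by move=> w' _; rewrite lee_fin.
    - by rewrite lee_fin.
    over.
  rewrite ge0_integralZr//.
  - exact/measurable_EFinP.
  - by move=> w _; rewrite lee_fin.
  - by apply: integral_ge0 => w _; rewrite lee_fin.
- apply/measurable_EFinP; apply: measurable_funM.
    exact: (measurableT_comp (mY i)).
  suff mG : measurable_fun setT
      ((fun w => \prod_(j <- J) Y j w)%R : g_sigma_algebraType (others i) -> R).
    exact: (measurableT_comp mG).
  apply: measurable_prod => j jJ.
  apply: (measurable_fun_sub_sigma_algebra _ (mY j)) => B FB.
  apply: sub_sigma_algebra; exists j => //=.
  by apply: contra iJ => /eqP <-.
- by move=> w w'; rewrite lee_fin mulr_ge0.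
Qed.

End independent_product.

Section conditional_bernoulli.
Context d (T : measurableType d) (R : realType) (P : probability T R).
Variables (G : set_system T) (L : nat -> set T) (p : nat -> T -> R).
Hypotheses (Gm : G `<=` measurable) (Gs : sigma_algebra setT G).
Hypothesis mL : forall n, measurable (L n).
Hypotheses (mp : forall n, measurable_fun setT (p n)).
Hypothesis p0 : forall n w, 0 <= p n w.
Hypothesis LP : conditionally_bernoulli P G L p.
Local Open Scope ereal_scope.

Let indic_bigsetI (J : seq nat) w :
  \1_(\big[setI/setT]_(j <- J) L j) w = (\prod_(j <- J) \1_(L j) w)%R :> R.
Proof.
elim: J => [|j J IHJ]; first by rewrite !big_nil indicE in_setT.
by rewrite !big_cons indicI/= IHJ.
Qed.

(** On [G], the measure that sends [B] to the probability of [B] intersected with all the [L j] has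
    two densities: the product of the indicators, trivially, and the product of the [p j], by
    hypothesis. Both sides integrate the [G]-measurable [Z] against this one measure. *)
Lemma integral_conditionally_bernoulli (J : seq nat) (Z : T -> R) : uniq J ->
  measurable_fun setT (Z : g_sigma_algebraType G -> R) ->
  (forall w, (0 <= Z w)%R) ->
  \int[P]_w (Z w * \prod_(j <- J) \1_(L j) w)%:E
  = \int[P]_w (Z w * \prod_(j <- J) p j w)%:E.
Proof.
move=> uJ mZ Z0.
have mid : measurable_fun setT (id : T -> g_sigma_algebraType G).
  move=> _ B; rewrite setTI preimage_id => mB.
  by apply: (smallest_sub _ Gm) mB; exact: sigma_algebra_measurable.
pose mid' := isMeasurableFun.Build _ _ _ _ (id : T -> g_sigma_algebraType G) mid.
pose idG : {mfun T >-> g_sigma_algebraType G} :=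
  HB.pack (id : T -> g_sigma_algebraType G) mid'.
have mLJ : measurable (\big[setI/setT]_(j <- J) L j) by exact: bigsetI_measurable.
have ZE (g : T -> R) : measurable_fun setT g -> (forall w, (0 <= g w)%R) ->
    (forall B, G B -> P (B `&` \big[setI/setT]_(j <- J) L j)
      = \int[P]_(w in B) (g w)%:E) ->
    \int[pushforward (mrestr P mLJ) idG]_w (Z w)%:E
    = \int[P]_w (Z w * g w)%:E.
  move=> mg g0 gE.
  rewrite (@ge0_integral_density _ _ _ _ _ P
    (pushforward (mrestr P mLJ) idG) id g)//.
  - move=> B mB; rewrite preimage_id -gE//.
    by rewrite -(sigma_algebra_id Gs).
  - exact/measurable_EFinP.
rewrite -ZE.
- rewrite -ZE//.
  + by apply: measurable_prod => j _; exact: mp.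
  + by move=> w; apply: prodr_ge0.
  + by move=> B GB; exact: LP.
- by apply: measurable_prod => j _; exact: measurable_indic.
- by move=> w; apply: prodr_ge0.
- move=> B /Gm mB; under eq_integral do rewrite -indic_bigsetI.
  by rewrite integral_indic// setIC.
Qed.

End conditional_bernoulli.

Section inclusion_exclusion.
Context d (T : measurableType d) (R : realType) (P : probability T R).
Variables (I : eqType) (V v : I -> T -> R).
Hypotheses (mV : forall i, measurable_fun setT (V i)).
Hypotheses (mv : forall i, measurable_fun setT (v i)).
Hypotheses (V01 : forall i w, 0 <= V i w <= 1) (v01 : forall i w, 0 <= v i w <= 1).
Local Open Scope ereal_scope.
Hypothesis Vv : forall J : seq I, uniq J ->
  \int[P]_w (\prod_(i <- J) V i w)%:E = \int[P]_w (\prod_(i <- J) v i w)%:E.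

Let mixed (U : I -> T -> R) (J J' : seq I) w : R :=
  (\prod_(i <- J) (1 - U i w) * \prod_(i <- J') U i w)%R.

(** This is [(1 - u) + u = 1] under the integral. A sum avoids subtracting extended reals;
    finiteness of the second term allows it to be cancelled afterwards. *)
Let mixedD (U : I -> T -> R) j J J' :
  (forall i, measurable_fun setT (U i)) -> (forall i w, (0 <= U i w <= 1)%R) ->
  \int[P]_w (mixed U (j :: J) J' w)%:E + \int[P]_w (mixed U J (j :: J') w)%:E
    = \int[P]_w (mixed U J J' w)%:E
  /\ \int[P]_w (mixed U J (j :: J') w)%:E \is a fin_num.
Proof.
move=> mU U01.
have m0 A B w : (0 <= mixed U A B w)%R.
  rewrite mulr_ge0// prodr_ge0// => i _; have /andP[] := U01 i w => //.
  by rewrite subr_ge0.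
have m1 A B w : (mixed U A B w <= 1)%R.
  rewrite mulr_ile1 ?prodr_ge0 ?prodr_ile1// => i _;
    by have /andP[? ?] := U01 i w; rewrite ?subr_ge0 ?gerBl ?U01 //; lra.
have mm A B : measurable_fun setT (fun w => (mixed U A B w)%:E).
  apply/measurable_EFinP; apply: measurable_funM; apply: measurable_prod => // i _.
  exact: measurable_funB.
split.
  rewrite -ge0_integralD//; try by move=> w _; rewrite lee_fin.
  apply: eq_integral => w _; rewrite -EFinD /mixed !big_cons; congr EFin; ring.
rewrite ge0_fin_numE ?integral_ge0//; last by move=> w _; rewrite lee_fin.
apply: (@le_lt_trans _ _ (\int[P]_w 1)).
  by apply: ge0_le_integral => // w _; rewrite lee_fin.
by rewrite integral_cst//= mul1e (le_lt_trans (probability_le1 _ _)) ?ltry.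
Qed.

(** Instead of summing over subsets, the induction trades one factor [1 - U j] for a factor [U j];
    it closes because the list [J'] of plain factors is arbitrary. Once [J] is empty, [Vv]
    applies. *)
Lemma integral_prod_onem (J : seq I) : uniq J ->
  \int[P]_w (\prod_(i <- J) (1 - V i w))%:E
  = \int[P]_w (\prod_(i <- J) (1 - v i w))%:E.
Proof.
suff H J' : uniq (J ++ J') ->
    \int[P]_w (mixed V J J' w)%:E = \int[P]_w (mixed v J J' w)%:E.
  move=> uJ; have := H [::]; rewrite cats0 => /(_ uJ).
  by congr (_ = _); apply: eq_integral => w _; rewrite /mixed big_nil mulr1.
elim: J J' => [|j J IHJ] J' uJ.
  transitivity (\int[P]_w (\prod_(i <- J') V i w)%:E).
    by apply: eq_integral => w _; rewrite /mixed big_nil mul1r.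
  by rewrite Vv//; apply: eq_integral => w _; rewrite /mixed big_nil mul1r.
have [EV fV] := mixedD j J J' mV V01; have [Ev fv] := mixedD j J J' mv v01.
have uJ' : uniq (J ++ j :: J').
  by rewrite -(perm_uniq (permEl (perm_catCA [:: j] J J'))).
move: EV; rewrite (IHJ J') ?(IHJ (j :: J'))//; last by case/andP: uJ.
rewrite -Ev => /(congr1 (fun x => x - \int[P]_w (mixed v J (j :: J') w)%:E)).
by rewrite !addeK.
Qed.

End inclusion_exclusion.

(** * The Laplace functional of a Poisson process *)

Section expeR_analysis.
Context {R : realType}.
Local Open Scope ereal_scope.

Lemma measurable_expeR : measurable_fun setT (@expeR R).
Proof.
apply: (measurability _ (ErealGenOInfty.measurableE R)) => //.
move=> _ [_ [r ->] <-]; rewrite setTI.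
have [r0|r0] := ltP r 0%R.
  have -> : expeR @^-1` `]r%:E, +oo[%classic = [set: \bar R]; last by [].
  apply/seteqP; split => // x _ /=.
  by rewrite in_itv/= andbT (lt_le_trans _ (expeR_ge0 x))// lte_fin.
have [y yr] := @expeR_total R r%:E r0.
have -> : expeR @^-1` `]r%:E, +oo[%classic = `]y, +oo[%classic :> set (\bar R).
  by apply/seteqP; split => x /=; rewrite !in_itv/= !andbT -yr lte_expeR.
exact: emeasurable_itv.
Qed.

(** The point [-oo] matters: a series of contributions may diverge, and the exponentials of the
    opposite partial sums must then tend to [expeR -oo = 0]. *)
Lemma continuous_expeR : continuous (@expeR R).
Proof.
move=> [r| |].
- by move=> A nA; exact: (@continuous_expR R r (fun s => A s%:E) nA).
- suff : expeR x @[x --> (+oo : \bar R)] --> (+oo : \bar R) by [].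
  apply/(@cvgeyPge _ _ (nbhs (+oo : \bar R))) => A; near=> y.
  rewrite (le_trans _ (expeR_ge1Dx y))// (@le_trans _ _ y)//.
    by near: y; apply: ereal_nbhs_pinfty_ge; exact: num_real.
  by rewrite leeDr.
- suff : expeR x @[x --> (-oo : \bar R)] --> (0%:E : \bar R) by [].
  apply/(@fine_cvgP _ _ (nbhs (-oo : \bar R))); split.
    have F y : y < 0 -> expeR y \is a fin_num by case: y.
    by near=> y; apply: F; near: y; apply: ereal_nbhs_ninfty_lt; exact: num_real.
  apply/cvgrPdist_le => e e0.
  have F y : y <= (ln e)%:E -> (`|0 - (fine \o expeR) y| <= e)%R.
    case: y => //= [s|_]; last by rewrite subr0 normr0 ltW.
    by rewrite sub0r normrN ger0_norm ?expR_ge0// lee_fin -ler_expR lnK.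
  by near=> y; apply: F; near: y; apply: ereal_nbhs_ninfty_le; exact: num_real.
Unshelve. all: by end_near. Qed.

Lemma nneseries_exp_coeff (x : R) : (0 <= x)%R ->
  \sum_(k <oo) (x ^+ k / k`!%:R)%:E = (expR x)%:E.
Proof.
move=> x0; rewrite expRE -EFin_lim; last first.
  rewrite /pseries/=; under eq_fun do rewrite mulrC.
  exact: is_cvg_series_exp_coeff.
apply/congr_lim/funext => n/=; rewrite /pseries/= /series/= -sumEFin//.
by under eq_bigr do rewrite mulrC.
Qed.

Lemma expeRN_le1 (x : \bar R) : 0 <= x -> expeR (- x) <= 1.
Proof. by move=> x0; rewrite -expeR0 lee_expeR oppe_le0. Qed.

End expeR_analysis.

Section poisson_count.
Context d (T : measurableType d) (R : realType) (P : probability T R).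
Variables (lambda : R) (X : nat -> {mfun T >-> (R * R)%type}).
Hypothesis lambda0 : 0 <= lambda.
Hypothesis PX : homogeneous_poisson_process P lambda X.
Local Open Scope ereal_scope.

Lemma measurable_point_count (B : set (R * R)) : measurable B ->
  measurable_fun setT (point_count X B).
Proof.
move=> mB; apply: ge0_emeasurable_sum => // n _.
rewrite (_ : (fun w => _) = EFin \o (\1_B \o X n))//.
by apply/measurable_EFinP/measurableT_comp.
Qed.

Lemma point_count_ge0 (B : set (R * R)) w : 0 <= point_count X B w.
Proof. by apply: nneseries_ge0. Qed.

Lemma laplace_point_count (B : set (R * R)) (t : R) :
  measurable B -> area B < +oo -> (0 <= t)%R ->
  \int[P]_w expeR (- (t%:E * point_count X B w))
  = (expR (- (lambda * fine (area B) * (1 - expR (- t)))))%:E.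
Proof.
move=> mB Boo t0.
pose m := (lambda * fine (area B))%R.
have m0 : (0 <= m)%R by rewrite mulr_ge0// fine_ge0.
pose K k := [set w | point_count X B w = k%:R%:E].
have PK k : P (K k) = (m ^+ k / k`!%:R * expR (- m))%:E by rewrite PX.1.
have mK k : measurable (K k).
  rewrite -[K k]setTI.
  exact: (measurable_point_count mB measurableT (emeasurable_set1 k%:R%:E)).
have tK : trivIset setT K.
  move=> i j _ _ [w []]; rewrite /K /= => -> /eqP.
  by rewrite eqe eqr_nat => /eqP.
have mf : measurable_fun setT (fun w => expeR (- (t%:E * point_count X B w))).
  apply: (measurableT_comp measurable_expeR).
  apply: (measurableT_comp (@oppe_measurable R setT)).
  apply: emeasurable_funM; first exact: measurable_cst.
  exact: measurable_point_count.
(* The Poisson weights sum to 1, so the count is almost surely a natural number; in particular the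
   value [+oo] is negligible. *)
have PKT : P (\bigcup_k K k) = 1.
  rewrite measure_bigcup//.
  transitivity (\sum_(k <oo) ((expR (- m))%:E * (m ^+ k / k`!%:R)%:E)).
    rewrite (eq_eseriesl (Q := xpredT)); last by move=> k; rewrite in_setT.
    by apply: eq_eseriesr => k _; rewrite -[RHS]EFinM mulrC; exact: PK.
  rewrite nneseriesZl; last by move=> k _; rewrite lee_fin divr_ge0// exprn_ge0.
  by rewrite nneseries_exp_coeff// -EFinM expRN mulVf// gt_eqF// expR_gt0.
have mKT : measurable (\bigcup_k K k) by exact: bigcupT_measurable.
rewrite (ge0_negligible_integral (measurableC mKT))//; last 2 first.
- by move=> w _; exact: expeR_ge0.
- transitivity (1 - P (\bigcup_k K k)); first exact: probability_setC.
  by rewrite PKT subee.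
rewrite setTD setCK ge0_integral_bigcup//; last 2 first.
- exact: measurable_funTS.
- by move=> w _; exact: expeR_ge0.
(* On [K k] the integrand is constant, equal to [expR (- t) ^+ k]; absorbing it in the weight leaves
   an exponential series in [m * expR (- t)]. *)
transitivity (\sum_(k <oo) ((expR (- m))%:E * ((m * expR (- t)) ^+ k / k`!%:R)%:E)).
  apply: eq_eseriesr => k _.
  rewrite (eq_integral (cst (expR (- t) ^+ k)%:E)); last first.
    move=> w /set_mem; rewrite /K /= => ->.
    by rewrite -EFinM/= mulrC -mulrN expRM_natl.
  rewrite integral_cst//; transitivity ((expR (- t) ^+ k)%:E *
    (m ^+ k / k`!%:R * expR (- m))%:E); first by congr (_ * _); exact: PK.
  rewrite -EFinM -EFinM [in RHS]exprMn; congr EFin.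
  by move: (m ^+ k)%R (expR (- t) ^+ k)%R (k`!%:R^-1)%R => u v z; ring.
rewrite nneseriesZl; last first.
  by move=> k _; rewrite lee_fin divr_ge0// exprn_ge0// mulr_ge0// expR_ge0.
rewrite nneseries_exp_coeff; last by rewrite mulr_ge0// expR_ge0.
rewrite -EFinM -expRD.
by congr (expR _)%:E; rewrite /m; ring.
Qed.

End poisson_count.

Section area_measure.
Context (R : realType).
Local Open Scope ereal_scope.
(** [area] is declared as a bare set function on [R * R]; its measure axioms are transported from
    the product measure so that it can be integrated against. *)
Let m : {measure set (measurableTypeR R * measurableTypeR R)%type -> \bar R} :=
  (@lebesgue_measure R \x @lebesgue_measure R).

Let area0 : @area R set0 = 0. Proof. exact: (measure0 m). Qed.
Let area_ge0 (B : set (R * R)) : 0 <= @area R B. Proof. exact: (measure_ge0 m). Qed.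
Let area_sigma : semi_sigma_additive (@area R).
Proof. exact: (@measure_semi_sigma_additive _ _ _ m). Qed.
HB.instance Definition _ :=
  isMeasure.Build _ (R * R)%type R (@area R) area0 area_ge0 area_sigma.

End area_measure.

Section poisson_laplace.
Context d (T : measurableType d) (R : realType) (P : probability T R).
Variables (lambda : R) (X : nat -> {mfun T >-> (R * R)%type}).
Hypothesis lambda0 : 0 <= lambda.
Hypothesis PX : homogeneous_poisson_process P lambda X.
Local Open Scope ereal_scope.

Section simple.
Variables (N : nat) (t : 'I_N -> R) (B : 'I_N -> set (R * R)).
Hypotheses (t0 : forall i, (0 <= t i)%R).
Hypotheses (mB : forall i, measurable (B i)).
Hypotheses (Boo : forall i, area (B i) < +oo) (tB : trivIset setT B).
Let f x : R := (\sum_(i < N) t i * \1_(B i) x)%R.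

(** The [B i] are disjoint, so at most one indicator is nonzero at [x]. *)
Let expR_f x : (1 - expR (- f x) = \sum_(i < N) (1 - expR (- t i)) * \1_(B i) x)%R.
Proof.
have [[i Bi]|nB] := pselect (exists i, B i x).
  have nBj j : j != i -> \1_(B j) x = 0%R :> R.
    move=> ji; rewrite indicE memNset// => Bj.
    by move/eqP: ji; apply; apply: (tB (i := j) (j := i)) => //; exists x.
  rewrite /f (bigD1 i)//= [in RHS](bigD1 i)//= !big1 => [|j /nBj->|j /nBj->].
  - by rewrite indicE mem_set// !mulr1 !addr0.
  - by rewrite mulr0.
  - by rewrite mulr0.
have nBj j : \1_(B j) x = 0%R :> R.
  by rewrite indicE memNset// => Bj; apply: nB; exists j.
by rewrite /f !big1 ?oppr0 ?expR0 ?subrr// => j _; rewrite nBj mulr0.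
Qed.

Let sum_f w : \sum_(n <oo) (f (X n w))%:E
  = \sum_(i < N) (t i)%:E * point_count X (B i) w.
Proof.
under eq_eseriesr do rewrite /f -sumEFin.
rewrite nneseries_sum => [|i j _]; last by rewrite lee_fin mulr_ge0.
apply: eq_bigr => i _; under eq_eseriesr do rewrite EFinM.
by rewrite nneseriesZl.
Qed.

(** The product formula for independent factors takes real factors; [fine] loses nothing here since
    the exponential lies between 0 and 1. *)
Let Y i w : R := fine (expeR (- ((t i)%:E * point_count X (B i) w))).

Let YE i w : (Y i w)%:E = expeR (- ((t i)%:E * point_count X (B i) w)).
Proof.
rewrite /Y fineK// ge0_fin_numE ?expeR_ge0// (@le_lt_trans _ _ 1) ?ltry//.
by rewrite expeRN_le1// mule_ge0 ?lee_fin// point_count_ge0.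
Qed.

(** The sum over the points is a combination of the counts in the disjoint sets [B i]. These are
    independent, so the expectation is a product of Poisson Laplace transforms. *)
Lemma laplace_poisson_simple :
  \int[P]_w expeR (- \sum_(n <oo) (f (X n w))%:E)
  = expeR (- (lambda%:E * \int[area]_x (1 - expR (- f x))%:E)).
Proof.
have expeRN_sum (r : seq 'I_N) w :
    expeR (- \sum_(i <- r) (t i)%:E * point_count X (B i) w)
    = (\prod_(i <- r) Y i w)%:E.
  elim: r => [|i r IHr]; first by rewrite !big_nil oppe0 expeR0.
  rewrite !big_cons EFinM -IHr YE -expeRD; congr expeR.
  rewrite oppeD// ge0_adde_def// inE ?mule_ge0 ?lee_fin ?point_count_ge0//.
  by apply: sume_ge0 => j _; rewrite mule_ge0 ?lee_fin ?point_count_ge0.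
transitivity (\int[P]_w (\prod_(i < N) Y i w)%:E).
  by apply: eq_integral => w _; rewrite sum_f expeRN_sum.
pose F i := generated_by (point_count X (B i)).
have [_ /(_ N B (fun i => conj (mB i) (Boo i)) tB) indF] := PX.
rewrite (integral_prod_independent _ _ indF).
- transitivity (\prod_(i < N)
      (expR (- (lambda * fine (area (B i)) * (1 - expR (- t i)))))%:E).
    apply: eq_bigr => i _; rewrite -(laplace_point_count lambda0 PX)//.
    by apply: eq_integral => w _; rewrite YE.
  rewrite prodEFin -expR_sum.
  have c0 i : (0 <= 1 - expR (- t i))%R.
    by rewrite subr_ge0 -expR0 ler_expR oppr_le0.
  under eq_integral do rewrite expR_f -sumEFin.
  rewrite ge0_integral_sum//; last 2 first.
  - move=> i; apply/measurable_EFinP; apply: measurable_funM => //.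
  - by move=> i x _; rewrite lee_fin mulr_ge0.
  rewrite (eq_bigr (fun i => ((1 - expR (- t i)) * fine (area (B i)))%:E)).
    rewrite sumEFin -EFinM/= mulr_sumr sumrN; congr (expR (- _))%:E.
    by apply: eq_bigr => i _; ring.
  move=> i _; under eq_integral do rewrite EFinM.
  rewrite ge0_integralZl//; last 2 first.
  - exact/measurable_EFinP/measurable_indic.
  - by rewrite lee_fin.
  rewrite integral_indic// setIT EFinM fineK// ge0_fin_numE//.
- move=> i _ [A mA <-]; exact: measurable_point_count.
- move=> i; apply: sigma_algebra_preimage; exact: sigma_algebra_measurable.
- exact: index_enum_uniq.
- move=> i; apply: measurableT_comp => //.
  apply: (measurableT_comp measurable_expeR).
  apply: (measurableT_comp (@oppe_measurable R setT)).
  apply: emeasurable_funM; first exact: measurable_cst.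
  by apply: measurable_fun_generated_by; exact: sub_sigma_algebra.
- by move=> i w; rewrite fine_ge0// expeR_ge0.
Qed.

End simple.

(** The law of the counts is given for sets of finite area only, so test functions are truncated to
    squares that exhaust the plane. *)
Let K (k : nat) : set (R * R) := (`[- k%:R, k%:R] `*` `[- k%:R, k%:R])%R%classic.

Let mK k : measurable (K k).
Proof. by apply: measurableX; exact: measurable_itv. Qed.

Let area_K k : area (K k) < +oo.
Proof.
have Ioo : @lebesgue_measure R [set` `[- k%:R, k%:R]%R] < +oo.
  by rewrite lebesgue_measure_itv/=; case: ifPn => // _; rewrite -EFinD ltry.
rewrite /area /K product_measure1E; [|exact: measurable_itv..].
by rewrite lte_mul_pinfty// ge0_fin_numE.
Qed.

Let K_nd j k : (j <= k)%N -> K j `<=` K k.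
Proof.
move=> jk; have jkR : (j%:R <= k%:R :> R)%R by rewrite ler_nat.
move=> [x y] []; rewrite /K /= !in_itv/= => /andP[x1 x2] /andP[y1 y2].
by rewrite !(le_trans _ x1) ?(le_trans x2) ?(le_trans _ y1) ?(le_trans y2) ?lerN2.
Qed.

Let K_cover x : \forall k \near \oo, K k x.
Proof.
near=> k; have : (`|x.1| <= k%:R)%R by near: k; exact: nbhs_infty_ger.
have : (`|x.2| <= k%:R)%R by near: k; exact: nbhs_infty_ger.
by rewrite /K/= !in_itv/= !ler_norml.
Unshelve. all: by end_near. Qed.

Import HBNNSimple.

(** No integrability is assumed: for [lambda > 0], an infinite integral on the right means that both
    sides are 0. *)
Lemma laplace_poisson (f : R * R -> R) : measurable_fun setT f ->
  (forall x, (0 <= f x)%R) ->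
  \int[P]_w expeR (- \sum_(n <oo) (f (X n w))%:E)
  = expeR (- (lambda%:E * \int[area]_x (1 - expR (- f x))%:E)).
Proof.
move=> mf f0.
have mEf : measurable_fun setT (EFin \o f) by exact/measurable_EFinP.
pose fa := nnsfun_approx measurableT mEf.
pose g k x : R := (fa k x * \1_(K k) x)%R.
have g0 k x : (0 <= g k x)%R by rewrite mulr_ge0.
have mg k : measurable_fun setT (g k) by apply: measurable_funM => //; exact: measurable_indic.
have gf x : g k x @[k --> \oo] --> f x.
  have : (fa k x)%:E @[k --> \oo] --> (f x)%:E.
    by apply: cvg_nnsfun_approx => // y _; rewrite lee_fin.
  move=> /fine_cvgP[_] /=; apply: cvg_trans; apply: near_eq_cvg.
  near=> k; rewrite /g indicE mem_set ?mulr1//; near: k; exact: K_cover.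
have g_nd x j k : (j <= k)%N -> (g j x <= g k x)%R.
  move=> jk; rewrite ler_pM//; first exact/lefP/nd_nnsfun_approx.
  rewrite !indicE; have [xj|//] := boolP (x \in K j).
  by rewrite (mem_set (K_nd jk (set_mem xj))).
have Eg k : \int[P]_w expeR (- \sum_(n <oo) (g k (X n w))%:E)
    = expeR (- (lambda%:E * \int[area]_x (1 - expR (- g k x))%:E)).
  pose s := finmap.enum_fset (fset_set (range (fa k))).
  pose N := size s.
  pose t (i : 'I_N) := nth 0%R s i.
  (* Level sets cut by the square: disjoint because the enumeration [s] of the range has no
     repetition, and of finite area even for the level 0. *)
  pose B (i : 'I_N) := fa k @^-1` [set t i] `&` K k.
  have -> : g k = (fun x => \sum_(i < N) t i * \1_(B i) x)%R.
    apply/funext => x; rewrite /g fimfunEord mulr_suml.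
    by apply: eq_bigr => i _; rewrite /B indicI/= mulrA.
  have ts (i : 'I_N) : t i \in s by exact: mem_nth.
  have mB i : measurable (B i) by apply: measurableI.
  apply: (@laplace_poisson_simple N t B) => //.
  - move=> i; have := ts i; rewrite in_fset_set// => /set_mem[x _ <-] //.
  - move=> i; apply: le_lt_trans (area_K k).
    by apply: le_measure; rewrite ?inE//; exact: subIsetr.
  - move=> i j _ _ [x [[/= Bi _] [/= Bj _]]]; apply/val_inj/eqP.
    rewrite -(@nth_uniq _ 0%R s i j (ltn_ord i) (ltn_ord j) (finmap.fset_uniq _)).
    apply/eqP.
    exact: (etrans (esym Bi) Bj).
have cL : \int[P]_w expeR (- \sum_(n <oo) (g k (X n w))%:E) @[k --> \oo]
    --> \int[P]_w expeR (- \sum_(n <oo) (f (X n w))%:E).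
  have cS w : \sum_(n <oo) (g k (X n w))%:E @[k --> \oo]
      --> \sum_(n <oo) (f (X n w))%:E.
    (* Read as an integral for the counting measure, the series obeys monotone convergence. *)
    have countE (u : R * R -> R) : (forall x, (0 <= u x)%R) ->
        \sum_(n <oo) (u (X n w))%:E = \int[counting]_n (u (X n w))%:E.
      by move=> u0; rewrite ge0_integral_count// => n; rewrite lee_fin.
    rewrite countE//; under eq_fun do rewrite countE//.
    rewrite (eq_integral (fun n => limn (fun k => (g k (X n w))%:E))); last first.
      move=> n _; apply/esym/cvg_lim => //; apply: cvg_EFin; last exact: gf.
      exact: nearW.
    apply: cvg_monotone_convergence => //.
    - by move=> m n _; rewrite lee_fin.
    - by move=> n _ j m jm; rewrite lee_fin g_nd.
  have mS (u : R * R -> R) : measurable_fun setT u -> (forall x, (0 <= u x)%R) ->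
      measurable_fun setT (fun w => expeR (- \sum_(n <oo) (u (X n w))%:E)).
    move=> mu u0; apply: (measurableT_comp measurable_expeR).
    apply: (measurableT_comp (@oppe_measurable R setT)).
    apply: ge0_emeasurable_sum => [n w _ _|n _]; first by rewrite lee_fin.
    by apply/measurable_EFinP; exact: measurableT_comp.
  (* The exponentials decrease as [g k] increases, hence domination by 1 rather than monotone
     convergence. *)
  apply: (@dominated_cvg _ _ _ P setT measurableT _ _ (cst 1)) => //.
  - by move=> k; exact: mS.
  - move=> w _; apply: continuous_cvg; first exact: continuous_expeR.
    exact/cvgeN/cS.
  - exact: finite_measure_integrable_cst.
  - move=> k w _ /=; rewrite gee0_abs ?expeR_ge0// expeRN_le1// nneseries_ge0//.
    by move=> n _ _; rewrite lee_fin.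
have cR : expeR (- (lambda%:E * \int[area]_x (1 - expR (- g k x))%:E)) @[k --> \oo]
    --> expeR (- (lambda%:E * \int[area]_x (1 - expR (- f x))%:E)).
  apply: continuous_cvg; first exact: continuous_expeR.
  apply: cvgeN; apply: cvgeZl => //.
  rewrite (eq_integral (fun x => limn (fun k => (1 - expR (- g k x))%:E))); last first.
    move=> x _; apply/esym/cvg_lim => //; apply: cvg_EFin.
      exact: nearW.
    apply: cvgB; first exact: cvg_cst.
    apply: continuous_cvg; first exact: continuous_expR.
    apply: cvgN; exact: gf.
  apply: cvg_monotone_convergence => //.
  - move=> k; apply/measurable_EFinP; apply: measurable_funB => //.
    exact/measurableT_comp/measurable_funN.
  - by move=> k x _; rewrite lee_fin subr_ge0 -expR0 ler_expR oppr_le0.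
  - by move=> x _ j k jk; rewrite lee_fin lerB// ler_expR lerN2 g_nd.
by rewrite -(cvg_lim _ cR)// -(cvg_lim _ cL)//; apply/congr_lim/funext.
Unshelve. all: by end_near. Qed.

End poisson_laplace.

(** * Beam coverage and fading *)

Section beam.
Context {R : realType}.
Implicit Types (u v theta Theta gamma c : R) (x y : R * R).

Lemma ler_cos : {in `[0, pi] &, {mono (@cos R) : u v /~ v <= u}}.
Proof. by move=> u v u0 v0; rewrite !leNgt ltr_cos. Qed.

Lemma cos_le_norm gamma v : 0 <= gamma <= pi -> `|v| <= pi ->
  (cos gamma <= cos v) = (`|v| <= gamma).
Proof.
move=> gpi vpi; rewrite -(cos_norm v) ler_cos// in_itv/=.
by rewrite normr_ge0.
Qed.

Lemma angle_representative c theta : exists2 u, c <= u < c + 2 * pi &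
  cos u = cos theta /\ sin u = sin theta.
Proof.
pose k := Num.floor ((theta - c) / (2 * pi)).
have p0 : 0 < 2 * pi :> R := two_pi_gt0.
exists (theta - k%:~R * (2 * pi)).
  have /andP[] := floor_itv ((theta - c) / (2 * pi)).
  rewrite -/k ler_pdivlMr// ltr_pdivrMr// intrD mulrDl mul1r => k1 k2.
  by apply/andP; split; lra.
have E : 2 * pi = pi *+ 2 :> R by rewrite mulr_natl.
(* [periodicn] takes a natural number of periods, hence the split on the sign of [k]. *)
case: k => n; rewrite E.
  set u := theta - _; have -> : theta = u + (pi *+ 2) *+ n.
    by rewrite /u -[Posz n]/(n%:Z) -pmulrn mulr_natl subrK.
  by rewrite (periodicn (@cosD2pi R)) (periodicn (@sinD2pi R)).
have -> : (Negz n)%:~R = - n.+1%:R :> R by rewrite NegzE mulrNz.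
rewrite mulNr opprK mulr_natl.
by rewrite (periodicn (@cosD2pi R)) (periodicn (@sinD2pi R)).
Qed.

Lemma dist2_ge0 x y : 0 <= dist2 x y.
Proof. exact: sqrtr_ge0. Qed.

Lemma dist2_sqr x y : dist2 x y ^+ 2 = (x.1 - y.1) ^+ 2 + (x.2 - y.2) ^+ 2.
Proof. by rewrite sqr_sqrtr// addr_ge0// sqr_ge0. Qed.

Lemma dist2C x y : dist2 x y = dist2 y x.
Proof. by rewrite /dist2 -(opprB y.1) -(opprB y.2) !sqrrN. Qed.

Lemma dist2_eq0 x y : (dist2 x y == 0) = (x == y).
Proof.
rewrite -sqrf_eq0 dist2_sqr paddr_eq0 ?sqr_ge0// !sqrf_eq0 !subr_eq0.
by case: x y => [? ?] [? ?].
Qed.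

Lemma direction_exists x y : exists theta, is_direction y x theta.
Proof.
have [d0|dN0] := eqVneq (dist2 x y) 0.
  exists 0; rewrite /is_direction d0 !mul0r.
  by move/eqP: d0; rewrite dist2_eq0 => /eqP ->; rewrite !subrr.
have d0 : 0 < dist2 x y by rewrite lt_neqAle eq_sym dN0 dist2_ge0.
pose p := (x.1 - y.1) / dist2 x y; pose q := (x.2 - y.2) / dist2 x y.
have pq : q ^+ 2 = 1 - p ^+ 2.
  apply/eqP; rewrite eq_sym subr_eq addrC /p /q !exprMn -mulrDl exprVn.
  by rewrite -dist2_sqr mulfV// sqrf_eq0.
have p1 : -1 <= p <= 1.
  rewrite -ler_norml -(@ler_pXn2r _ 2) ?nnegrE// expr1n real_normK ?num_real//.
  by rewrite -subr_ge0 -pq sqr_ge0.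
(* The sine is nonnegative at [acos p], which lies in [0, pi]; the sign of [q] selects the
   half-plane. *)
exists (if 0 <= q then acos p else - acos p).
rewrite /is_direction.
have -> : cos (if 0 <= q then acos p else - acos p) = p.
  by case: ifP => _; rewrite ?cosN acosK// in_itv.
have -> : sin (if 0 <= q then acos p else - acos p) = q.
  have Eq : sin (acos p) = `|q| by rewrite sin_acos// -pq sqrtr_sqr.
  case: ifPn => q0; rewrite ?sinN Eq; first by rewrite ger0_norm.
  by rewrite ltr0_norm ?opprK// ltNge.
by rewrite /p /q ![_ * (_ / _)]mulrC !divfK.
Qed.

(** The right side is the dot product of [x - y] with the unit vector of angle [Theta]: comparing
    cosines removes both the existential over determinations and the reduction modulo [2 * pi]. For
    [x = y] both sides hold. *)
Lemma beam_coversP gamma Theta y x : 0 < gamma <= 2 * pi ->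
  beam_covers gamma Theta y x <->
  dist2 x y * cos (gamma / 2)
    <= (x.1 - y.1) * cos Theta + (x.2 - y.2) * sin Theta.
Proof.
move=> /andP[g0 g2]; have hg : 0 <= gamma / 2 <= pi by apply/andP; split; lra.
have E theta : is_direction y x theta ->
    (x.1 - y.1) * cos Theta + (x.2 - y.2) * sin Theta
    = dist2 x y * cos (theta - Theta).
  by move=> [-> ->]; rewrite cosB; ring.
split=> [[theta [dir le_g]]|le_g].
  rewrite (E _ dir) ler_wpM2l ?dist2_ge0// cos_le_norm//.
  by case/andP: hg => _; exact: le_trans.
have [theta0 dir0] := direction_exists x y.
(* Among the determinations, the one within [pi] of [Theta], where [cos_le_norm] applies. *)
have [u /andP[u1 u2] [cu su]] := angle_representative (Theta - pi) theta0.
have dir : is_direction y x u by case: dir0 => d1 d2; split; rewrite ?cu ?su.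
have [d0|dN0] := eqVneq (dist2 x y) 0.
  exists Theta; split; last by rewrite subrr normr0; case/andP: hg.
  by case: dir0 => d1 d2; split; rewrite ?d1 ?d2 d0 !mul0r.
exists u; split => //; rewrite -cos_le_norm//; last first.
  by rewrite ler_norml; apply/andP; split; lra.
move: le_g; rewrite (E _ dir) ler_pM2l//.
by rewrite lt_neqAle eq_sym dN0 dist2_ge0.
Qed.

(** The arc starts at [c] and has length [gamma]; the second disjunct is the part that wraps past
    [2 * pi]. The angle [v] lies strictly between [- 2 * pi] and [3 * pi], so at most one shift by
    [2 * pi] brings it into [- pi, pi]. *)
Lemma cos_le_arc gamma c Theta : 0 < gamma <= 2 * pi -> 0 <= c < 2 * pi ->
  0 <= Theta < 2 * pi ->
  (cos (gamma / 2) <= cos (c + gamma / 2 - Theta))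
  = (c <= Theta <= c + gamma) || (Theta <= c + gamma - 2 * pi).
Proof.
move=> /andP[g0 g2] /andP[c0 c2] /andP[T0 T2].
have hg : 0 <= gamma / 2 <= pi by apply/andP; split; lra.
have [v vE] : exists v, c + gamma / 2 - Theta = v by eexists.
rewrite vE.
have E : pi *+ 2 = 2 * pi :> R by rewrite mulr_natl.
have [vpi|vpi] := leP `|v| pi.
  rewrite cos_le_norm//; move: vpi; rewrite !ler_norml => /andP[v1 v2].
  apply/andP/orP => [[]|]; first by move=> ? ?; left; apply/andP; split; lra.
  by case=> [/andP[? ?]|?]; split; lra.
have [v0|v0] := leP 0 v.
  rewrite ger0_norm// in vpi.
  rewrite -[v](subrK (pi *+ 2)) cosD2pi cos_le_norm//; last first.
    by rewrite E ler_norml; apply/andP; split; lra.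
  rewrite E !ler_norml; apply/andP/orP => [[? ?]|].
    by right; lra.
  by case=> [/andP[? ?]|?]; split; lra.
rewrite ltr0_norm// in vpi.
rewrite -(cosD2pi v) cos_le_norm//; last first.
  by rewrite E ler_norml; apply/andP; split; lra.
rewrite E !ler_norml; apply/andP/orP => [[? ?]|].
  by left; apply/andP; split; lra.
by case=> [/andP[? ?]|?]; split; lra.
Qed.

Let arc gamma c : set R := [set Theta | cos (gamma / 2) <= cos (c + gamma / 2 - Theta)].

Let measurable_arc gamma c : measurable (arc gamma c).
Proof.
rewrite -[arc gamma c]setTI; apply: measurable_fun_le => //.
apply: measurableT_comp; last exact: measurable_funB.
by apply: continuous_measurable_fun; exact: continuous_cos.
Qed.

Let lebesgue_arc gamma c : 0 < gamma <= 2 * pi -> 0 <= c < 2 * pi ->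
  @lebesgue_measure R (arc gamma c `&` `[0, 2 * pi[%classic) = gamma%:E.
Proof.
move=> g c02; have p0 := @pi_gt0 R; have [g0 g2] := andP g; have [c0 c2] := andP c02.
have [cg|cg] := ltP (c + gamma) (2 * pi).
  have -> : arc gamma c `&` `[0, 2 * pi[%classic = `[c, c + gamma]%classic.
    apply/seteqP; split => t; rewrite /arc/= !in_itv/=.
      move=> [+ t02]; rewrite cos_le_arc// => /orP[//|].
      by case/andP: t02 => ? ? ?; exfalso; lra.
    move=> /andP[t1 t2]; have t02 : 0 <= t < 2 * pi by apply/andP; split; lra.
    by split => //; rewrite cos_le_arc// t1 t2.
  rewrite lebesgue_measure_itv/= lte_fin ifT; last by rewrite ltrDl.
  by rewrite -EFinD addrAC subrr add0r.
(* When the arc wraps, its complement is a single gap of length [2 * pi - gamma], empty if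
   [gamma = 2 * pi]. *)
have -> : arc gamma c `&` `[0, 2 * pi[%classic
    = `[0, 2 * pi[%classic `\` `]c + gamma - 2 * pi, c[%classic.
  apply/seteqP; split => t; rewrite /arc/= !in_itv/=.
    move=> [+ t02]; rewrite cos_le_arc// => h; split => //.
    by move=> /andP[? ?]; case/orP: h => [/andP[? ?]|?]; lra.
  move=> [t02 h]; split => //; rewrite cos_le_arc//.
  have [ct|tc] := leP c t.
    by case/andP: t02 => ? ?; apply/orP; left; apply/andP; split; lra.
  by apply/orP; right; rewrite leNgt; apply/negP => ?; apply: h; apply/andP; split.
rewrite measureD//=; last first.
  by rewrite lebesgue_measure_itv/=; case: ifPn; rewrite ?ltry.
have -> : `[0, 2 * pi[%classic `&` `]c + gamma - 2 * pi, c[%classic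
    = `]c + gamma - 2 * pi, c[%classic.
  apply/seteqP; split => t /=; rewrite !in_itv/=; first by case.
  by move=> /andP[? ?]; split; apply/andP; split; lra.
rewrite !lebesgue_measure_itv/= !lte_fin two_pi_gt0.
have [h|h] := ltP (c + gamma - 2 * pi) c.
  by rewrite -!EFinD; congr EFin; lra.
by rewrite sube0 -EFinD; congr EFin; lra.
Qed.

Lemma uniform_prob_beam_covers gamma y x : 0 < gamma <= 2 * pi -> x != y ->
  uniform_prob (@two_pi_gt0 R) [set Theta | beam_covers gamma Theta y x]
  = (gamma / (2 * pi))%:E.
Proof.
move=> g xy.
have [theta dir] := direction_exists x y.
(* [u] is the centre of the arc; this choice puts its start [u - gamma / 2] in [0, 2 * pi). *)
have [u /andP[u1 u2] [cu su]] := angle_representative (gamma / 2) theta.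
have c02 : 0 <= u - gamma / 2 < 2 * pi by apply/andP; split; lra.
have -> : [set Theta | beam_covers gamma Theta y x] = arc gamma (u - gamma / 2).
  apply/seteqP; split => t; rewrite /arc/= subrK.
    move=> /(beam_coversP _ _ _ g); case: dir => -> ->.
    rewrite -!mulrA -mulrDr -cu -su -cosB ler_pM2l// lt_neqAle eq_sym dist2_eq0 xy.
    exact: dist2_ge0.
  move=> h; apply/(beam_coversP _ _ _ g); case: dir => -> ->.
  by rewrite -!mulrA -mulrDr -cu -su -cosB ler_wpM2l// dist2_ge0.
set S := arc _ _.
have mS : measurable S := measurable_arc _ _.
rewrite -[S]setIT -integral_indic//.
rewrite (@integral_uniform R _ _ _ (fun t => (\1_S t)%:E)) ?subr0//; last first.
  exact/measurable_EFinP/measurable_indic.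
rewrite integral_indic//.
(* The uniform law is carried by the closed interval; its right endpoint is negligible. *)
have -> : S `&` `[0, 2 * pi]%classic
    = (S `&` `[0, 2 * pi[%classic) `|` (S `&` [set 2 * pi]).
  by rewrite -setIUr setUitv1// bnd_simp ltW// two_pi_gt0.
rewrite measureU0; last 3 first.
- by apply: measurableI.
- by apply: measurableI.
- apply: (@subset_measure0 _ _ _ (@lebesgue_measure R) _ [set 2 * pi]) => //.
    exact: measurableI.
  exact: lebesgue_measure_set1.
by rewrite [X in (_ * X)%E](lebesgue_arc g c02) -EFinM mulrC.
Qed.

End beam.

Section exponential.
Context {R : realType}.
Local Open Scope ereal_scope.

Lemma integral_exponential_onem (nu : {measure set R -> \bar R}) (q : R) :
  (forall B, measurable B -> nu B = exponential_prob 1 B) -> (0 <= q)%R ->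
  \int[nu]_t (1 - expR (- (q * Num.max t 0)))%:E = (q / (1 + q))%:E.
Proof.
move=> nuE q0; have q1 : (0 < 1 + q)%R by rewrite ltr_pwDl.
pose f (t : R) : R := (1 - expR (- (q * Num.max t 0)))%R.
have f0 t : (0 <= f t)%R.
  by rewrite subr_ge0 -expR0 ler_expR oppr_le0 mulr_ge0// le_max lexx orbT.
have mf : measurable_fun setT f.
  apply: measurable_funB => //; apply: measurableT_comp => //.
  apply: measurable_funN; apply: measurable_funM => //.
  exact: measurable_maxr.
have pdf0 (c t : R) : (0 < c)%R -> (0 <= exponential_pdf c t)%R.
  by move=> c0; rewrite exponential_pdf_ge0// ltW.
rewrite (@ge0_integral_density _ _ _ _ _ (@lebesgue_measure R) nu id
  (exponential_pdf 1))//; last 3 first.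
- exact: measurable_exponential_pdf.
- by move=> t; exact: pdf0.
- exact/measurable_EFinP.
pose S := \int[@lebesgue_measure R]_t ((f t)%:E * (exponential_pdf 1 t)%:E).
(* For [t >= 0], the product of [expR (- (q * t))] and the density of rate 1 is [(1 + q)^-1] times
   the density of rate [1 + q]. Adding it to the integrand of [S] restores the density of rate 1, so
   only total masses are needed. *)
have SE : S + (1 + q)^-1%:E = 1.
  have := @integral_exponential_pdf R (1 + q) q1.
  move=> /(congr1 (fun x => (1 + q)^-1%:E * x)); rewrite mule1 => <-.
  rewrite -ge0_integralZl//; last 3 first.
  - by apply/measurable_EFinP; exact: measurable_exponential_pdf.
  - by move=> t _; rewrite lee_fin pdf0.
  - by rewrite lee_fin invr_ge0 ltW.
  rewrite -ge0_integralD//; last 4 first.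
  - by move=> t _; rewrite mule_ge0 ?lee_fin ?pdf0.
  - apply: emeasurable_funM; apply/measurable_EFinP => //.
    exact: measurable_exponential_pdf.
  - by move=> t _; rewrite mule_ge0 ?lee_fin ?pdf0// invr_ge0 ltW.
  - apply: emeasurable_funM => //; apply/measurable_EFinP.
    exact: measurable_exponential_pdf.
  rewrite -[RHS](@integral_exponential_pdf R 1)//.
  apply: eq_integral => t _; rewrite -!EFinM -EFinD; congr EFin.
  have [t0|t0] := leP 0%R t; last by rewrite !lt0_exponential_pdf// !mulr0 addr0.
  rewrite !exponential_pdfE// /f max_l// mul1r mulrA mulVf ?gt_eqF// mul1r.
  by rewrite mulrBl mul1r -expRD -addrA [X in (_ + X)%R](_ : _ = 0%R) ?addr0//
    addrC; apply/eqP; rewrite subr_eq0; apply/eqP; congr expR; ring.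
have S1 : S = 1 - (1 + q)^-1%:E by rewrite -SE addeK.
rewrite [LHS]S1 -EFinB; congr EFin; field.
by rewrite gt_eqF.
Qed.

End exponential.

(** * Polar coordinates *)

Section polar.
Context {R : realType}.
Implicit Types (F f : R -> R) (x : R * R).

Lemma is_derive_LRcontinuous F f (a b : R) :
  (forall t : R, is_derive t 1 F (f t)) ->
  derivable_oo_LRcontinuous F a b /\ F^`()%classic = f.
Proof.
move=> dF; have cF t : F @ t --> F t.
  have [dFt _] := dF t.
  by apply: differentiable_continuous; exact/derivable1_diffP.
split; last by apply/funext => t; rewrite derive1E; exact: derive_val.
split; first by move=> t _; exact: ex_derive.
- exact: cvg_at_right_filter.
- exact: cvg_at_left_filter.
Qed.

Lemma integral_circle (c r : R) : 0 < r ->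
  (\int[@lebesgue_measure R]_(u in `[(c - r)%R, (c + r)%R])
     (2 * Num.sqrt (r ^+ 2 - (u - c) ^+ 2))%:E = (pi * r ^+ 2)%:E)%E.
Proof.
move=> r0.
pose G (u : R) : R := 2 * Num.sqrt (r ^+ 2 - (u - c) ^+ 2).
(* The substitution [u = F t] reverses the orientation of [0, pi] and turns the chord into
   [2 * r * sin t]; [A] is a primitive of the resulting [2 * (r * sin t) ^+ 2]. *)
pose F (t : R) : R := c + r * cos t.
pose A (t : R) : R := r ^+ 2 * (t - sin t * cos t).
have dF (t : R) : is_derive t 1 F (- (r * sin t)).
  by rewrite /F; apply: is_derive_eq; rewrite /GRing.scale/=; ring.
have dA (t : R) : is_derive t 1 A (2 * (r * sin t) ^+ 2).
  rewrite /A; apply: is_derive_eq; rewrite /GRing.scale/=.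
  rewrite !expr2; have := cos2Dsin2 t; rewrite !expr2 => h; nra.
have [FLR dFE] := is_derive_LRcontinuous 0 pi dF.
have [ALR dAE] := is_derive_LRcontinuous 0 pi dA.
have F0 : F 0 = c + r by rewrite /F cos0 mulr1.
have Fpi : F pi = c - r by rewrite /F cospi mulrN1.
have csin : continuous (fun t : R => - (r * sin t)).
  by move=> t; apply: cvgN; apply: cvgM; [exact: cvg_cst|exact: continuous_sin].
rewrite -F0 -Fpi.
rewrite -[LHS]/(\int[lebesgue_measure]_(u in `[F pi, F 0%R]) (G u)%:E)%E.
rewrite (@integration_by_substitution_decreasing R F G 0 pi) ?pi_ge0//; last 5 first.
- move=> s t s0 t0 st; rewrite /F ltrD2l ltr_pM2l// ltr_cos//.
- by rewrite dFE => t _; exact: csin.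
- rewrite dFE; apply/cvg_ex; exists (- (r * sin 0)).
  by apply: cvg_at_right_filter; exact: csin.
- rewrite dFE; apply/cvg_ex; exists (- (r * sin pi)).
  by apply: cvg_at_left_filter; exact: csin.
- apply: continuous_subspaceT => u; apply: cvgM; first exact: cvg_cst.
  apply: continuous_cvg; first exact: sqrt_continuous.
  apply: cvgB; first exact: cvg_cst.
  apply: (@continuous_cvg _ _ _ _ _ _ (fun v : R => v ^+ 2)); first exact: exprn_continuous.
  by apply: cvgB; [exact: cvg_id|exact: cvg_cst].
transitivity (\int[lebesgue_measure]_(t in `[0%R, pi]) (2 * (r * sin t) ^+ 2)%:E)%E.
  apply: eq_integral => t; rewrite inE/= in_itv/= => t0; congr EFin.
  have s0 : 0 <= sin t by exact: sin_ge0_pi.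
  transitivity (G (F t) * - F^`()%classic t); first by [].
  rewrite dFE opprK /G /F.
  rewrite (_ : r ^+ 2 - _ = (r * sin t) ^+ 2); last first.
    by rewrite !exprMn sin2cos2; ring.
  by rewrite sqrtr_sqr ger0_norm ?mulr_ge0// ?(ltW r0)//; ring.
rewrite (@continuous_FTC2 R _ A) ?pi_gt0//.
- rewrite /A sinpi sin0 !mul0r !subr0 mulr0 sube0; congr EFin; ring.
- apply: continuous_subspaceT => t; apply: cvgM; first exact: cvg_cst.
  apply: (@continuous_cvg _ _ _ _ _ _ (fun v : R => v ^+ 2)); first exact: exprn_continuous.
  by apply: cvgM; [exact: cvg_cst|exact: continuous_sin].
- by move=> t _; rewrite dAE.
Qed.

Lemma measurable_dist2 x : measurable_fun setT (fun y => dist2 y x).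
Proof.
apply: (measurableT_comp (f := @Num.sqrt R)).
  by apply: continuous_measurable_fun; exact: sqrt_continuous.
by apply: measurable_funD; apply: measurable_funX; apply: measurable_funB.
Qed.

Lemma area_open_disk x (r : R) : 0 < r ->
  area [set y | dist2 y x < r] = (pi * r ^+ 2)%:E.
Proof.
move=> r0; rewrite /area /product_measure1.
pose s (u : R) : R := Num.sqrt (r ^+ 2 - (u - x.1) ^+ 2).
have normE (t w : R) : 0 <= w -> (t ^+ 2 < w ^+ 2) = (`|t| < w).
  by move=> w0; rewrite -(@ltr_pXn2r _ 2 _ `|t|) ?nnegrE// real_normK ?num_real.
have distE y : ((y.1 - x.1) ^+ 2 + (y.2 - x.2) ^+ 2 < r ^+ 2) = (dist2 y x < r).
  by rewrite -(@ltr_pXn2r _ 2 _ (dist2 y x)) ?nnegrE ?dist2_ge0 ?(ltW r0)// dist2_sqr.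
have sectionE u : xsection [set y | dist2 y x < r] u
    = `](x.2 - s u), (x.2 + s u)[%classic.
  apply/seteqP; split => v; rewrite /xsection/= inE/= in_itv/= -ltr_distl.
    move=> h; rewrite -normE; last exact: sqrtr_ge0.
    move: h; rewrite -distE/= => h; have h2 := sqr_ge0 (v - x.2).
    by rewrite sqr_sqrtr; lra.
  move=> h; have w0 : 0 < r ^+ 2 - (u - x.1) ^+ 2.
    by rewrite -sqrtr_gt0; exact: le_lt_trans h.
  rewrite -distE/=; move: h; rewrite -normE; last exact: sqrtr_ge0.
  by rewrite sqr_sqrtr ?(ltW w0)// => h; lra.
rewrite -(integral_circle x.1 r0) [RHS]integral_mkcond.
apply: eq_integral => u _ /=; rewrite sectionE patchE.
have -> : @lebesgue_measure R `](x.2 - s u), (x.2 + s u)[%classic = (2 * s u)%:E.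
  rewrite lebesgue_measure_itv/= lte_fin.
  have [h|h] := ltP (x.2 - s u) (x.2 + s u).
    by rewrite -EFinD; congr EFin; ring.
  by have := sqrtr_ge0 (r ^+ 2 - (u - x.1) ^+ 2); rewrite -/(s u) => h'; congr EFin; lra.
(* [Num.sqrt] is 0 on negative numbers, so the chords outside the disk have length 0. *)
case: ifPn => //; rewrite notin_setE/= in_itv/= => /negP h.
rewrite /s ler0_sqrtr ?mulr0//.
rewrite subr_le0 -(@real_normK _ (u - x.1)) ?num_real//.
rewrite ler_pXn2r ?nnegrE ?(ltW r0)// leNgt.
by apply: contra h; rewrite ltr_distl => /andP[/ltW -> /ltW ->].
Qed.

(** No change of variables in the plane: the image of [area] under the distance to [x] is identified
    as the measure with density [2 * pi * t] on the half-line. *)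
Lemma integral_radial x (phi : R -> \bar R) : measurable_fun setT phi ->
  (forall t, (0 <= phi t)%E) ->
  (\int[area]_y phi (dist2 y x)
   = \int[@lebesgue_measure R]_(t in `[0%R, +oo[) (phi t * (2 * pi * t)%:E))%E.
Proof.
move=> mphi phi0.
pose g (t : R) : R := 2 * pi * Num.max t 0.
have g0 t : 0 <= g t by rewrite mulr_ge0 ?(ltW two_pi_gt0)// le_max lexx orbT.
have mg : measurable_fun setT (g : measurableTypeR R -> R).
  by apply: measurable_funM => //; exact: measurable_maxr.
have [nu nuE] := @density_measure_exists _ _ R (@lebesgue_measure R) g mg g0.
pose rho : R * R -> measurableTypeR R := fun y => dist2 y x.
have mrho : measurable_fun setT rho := measurable_dist2 x.
pose hrho := isMeasurableFun.Build _ _ _ _ rho mrho.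
pose rhoM : {mfun (R * R)%type >-> measurableTypeR R} := HB.pack rho hrho.
have rays (r : R) : area (rhoM @^-1` `]-oo, r[%classic) = nu `]-oo, r[%classic.
  rewrite nuE integral_mkcond; have [r0|r0] := leP r 0.
    rewrite (_ : _ @^-1` _ = set0); last first.
      apply/seteqP; split => // y /=; rewrite in_itv/= /rho => yr.
      by have := dist2_ge0 y x; lra.
    rewrite measure0 integral0_eq// => t _; rewrite patchE; case: ifPn => //.
    rewrite inE/= in_itv/= => tr; rewrite /g max_r ?mulr0//; lra.
  have -> : rhoM @^-1` `]-oo, r[%classic = [set y | dist2 y x < r].
    by apply/seteqP; split => y /=; rewrite in_itv.
  rewrite area_open_disk//.
  pose A (t : R) : R := pi * t ^+ 2.
  have dA (t : R) : is_derive t 1 A (2 * pi * t).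
    by rewrite /A; apply: is_derive_eq; rewrite /GRing.scale/=; ring.
  have [ALR dAE] := is_derive_LRcontinuous 0 r dA.
  have c2 : continuous (fun t : R => 2 * pi * t).
    by move=> t; apply: cvgM; [exact: cvg_cst|exact: cvg_id].
  transitivity (\int[@lebesgue_measure R]_(t in `[0%R, r]) (2 * pi * t)%:E)%E.
    rewrite (@continuous_FTC2 R _ A)//.
    - by rewrite /A expr0n/= mulr0 sube0.
    - exact: continuous_subspaceT.
    - by move=> t _; rewrite dAE.
  rewrite -integral_itv_bndo_bndc; last first.
    by apply/measurable_EFinP/measurable_funTS; exact: continuous_measurable_fun.
  rewrite [LHS]integral_mkcond; apply: eq_integral => t _; rewrite !patchE.
  have -> : (t \in `[0%R, r[%classic) = (0 <= t < r) by apply/idP/idP; rewrite inE/= in_itv.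
  have -> : (t \in `]-oo, r[%classic) = (t < r) by apply/idP/idP; rewrite inE/= in_itv.
  rewrite /g; have [t0|t0] := leP 0 t => //=; case: ifP => // _.
  by rewrite mulr0.
have E B : measurable B -> pushforward (@area R) rhoM B = nu B.
  pose m1 :=
    measure_function_pushforward__canonical__measure_function_Measure (@area R) mrho.
  (* The rays []-oo, r[] generate the Borel sets and are stable under intersection; those with
     natural endpoints have finite measure and exhaust the line. *)
  apply: (@measure_unique _ R (measurableTypeR R) (@RGenInftyO.G R)
    (fun k => [set` `]-oo, k%:R[%R]) _ _ _ _ m1 nu).
  - exact: RGenInftyO.measurableE.
  - move=> _ _ [r ->] [r' ->]; exists (Num.min r r').
    apply/seteqP; split => t /=; rewrite !in_itv/= lt_min; first by case=> -> ->.
    by move=> /andP[].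
  - by move=> k; exists k%:R.
  - apply/seteqP; split => // t _; exists (Num.truncn `|t|).+1 => //=.
    by rewrite in_itv/= (le_lt_trans (ler_norm _))// truncnS_gt.
  - by move=> _ [r ->]; exact: rays.
  - move=> k; have [->|k0] := eqVneq k 0%N.
      rewrite [ltLHS]rays nuE integral0_eq ?ltry// => t; rewrite /= in_itv/= => t0.
      by rewrite /g max_r ?mulr0// ltW.
    rewrite [ltLHS](_ : _ = area [set y | dist2 y x < k%:R]).
      by rewrite area_open_disk ?ltry// ltr0n lt0n.
    by congr area; apply/seteqP; split => y /=; rewrite in_itv.
transitivity (\int[pushforward (@area R) rhoM]_t phi t)%E.
  by rewrite ge0_integral_pushforward.
rewrite (eq_measure_integral nu); last by move=> B mB _; exact: E.
rewrite (@ge0_integral_density _ _ _ _ _ (@lebesgue_measure R) nu id g)//.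
rewrite [RHS]integral_mkcond; apply: eq_integral => t _; rewrite patchE.
have -> : (t \in `[0%R, +oo[%classic) = (0 <= t).
  by apply/idP/idP; rewrite inE/= in_itv/= andbT.
by rewrite /g; have [t0|t0] := leP 0 t => //; rewrite mulr0 mule0.
Qed.

End polar.

(** * The interference *)

Section null_modification.
Context d (T : measurableType d) (R : realType) (mu : {measure set T -> \bar R}).
Local Open Scope ereal_scope.
Import HBNNSimple.

(* Unlike [ge0_ae_eq_integral], nothing has to be measurable apart from [N]. *)
Lemma ge0_integral_eq_off_null (f g : T -> \bar R) (N : set T) :
  (forall x, 0 <= f x) -> (forall x, 0 <= g x) ->
  measurable N -> mu N = 0 -> (forall x, ~ N x -> f x = g x) ->
  \int[mu]_x f x = \int[mu]_x g x.
Proof.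
move=> f0 g0 mN N0 fg.
suff le (u v : T -> \bar R) : (forall x, 0 <= u x) -> (forall x, 0 <= v x) ->
    (forall x, ~ N x -> u x = v x) -> \int[mu]_x u x <= \int[mu]_x v x.
  by apply/eqP; rewrite eq_le !le// => x Nx; rewrite fg.
move=> u0 v0 uv; rewrite !ge0_integralTE//.
apply: ge_ereal_sup => _ [k /= ku <-].
(* Setting [k] to 0 on [N] keeps its integral and puts it below [v] everywhere. *)
pose k' := mul_nnsfun k (indic_nnsfun R (measurableC mN)).
have -> : sintegral mu k = sintegral mu k'.
  rewrite -!integralT_nnsfun.
  apply: ge0_ae_eq_integral => //.
  - exact/measurable_EFinP.
  - exact/measurable_EFinP.
  - by move=> x _; rewrite lee_fin.
  - by move=> x _; rewrite lee_fin.
  exists N; split => // x /= kk'; apply: contrapT => Nx; apply: kk' => _.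
  by rewrite mindicE mem_set// mulr1.
apply: ereal_sup_ubound; exists k' => // x /=.
rewrite mindicE; have [xN|xN] := pselect (N x).
  by rewrite memNset ?mulr0//= => /(_ xN).
by rewrite mem_set// mulr1 -uv.
Qed.

End null_modification.

Section exponential_products.
Context d (T : measurableType d) (R : realType) (P : probability T R).
Local Open Scope ereal_scope.

Lemma cvg_integral_prod_expR (g : nat -> T -> R) :
  (forall n, measurable_fun setT (g n)) -> (forall n w, (0 <= g n w)%R) ->
  \int[P]_w (\prod_(0 <= n < N) expR (- g n w))%:E @[N --> \oo]
    --> \int[P]_w expeR (- \sum_(n <oo) (g n w)%:E).
Proof.
move=> mg g0.
apply: (@dominated_cvg _ _ _ P setT measurableT _ _ (cst 1)) => //.
- move=> N; apply/measurable_EFinP; apply: measurable_prod => n _.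
  exact/measurableT_comp/measurable_funN.
- move=> w _.
  rewrite (_ : (fun N => _) = (fun N => expeR (- \sum_(0 <= n < N) (g n w)%:E))).
    apply: continuous_cvg; first exact: continuous_expeR.
    apply: cvgeN; apply: is_cvg_nneseries => n _ _; by rewrite lee_fin.
  by apply/funext => N; rewrite sumEFin -expR_sum sumrN.
- exact: finite_measure_integrable_cst.
- move=> N w _ /=; rewrite ger0_norm.
    rewrite lee_fin prodr_ile1// => n _.
    by rewrite expR_ge0/= -expR0 ler_expR oppr_le0.
  by rewrite prodr_ge0// => n _; exact: expR_ge0.
Qed.

End exponential_products.

Lemma measurable_invr (R : realType) : measurable_fun setT (fun r : R => r^-1).
Proof.
(* The identity also holds at 0, where both sides are 0. *)
rewrite (_ : (fun r => _) = (fun r => r * (r ^+ 2) `^ (-1))); last first.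
  apply/funext => r; rewrite powR_inv1 ?sqr_ge0//.
  have [->|r0] := eqVneq r 0; first by rewrite invr0 mul0r.
  by rewrite expr2 invfM mulrA mulfV// mul1r.
apply: measurable_funM => //.
exact: (@measurableT_comp _ _ _ _ _ _ (fun x : R => x `^ (-1))).
Qed.

Section interference.
Context (R : realType) (d : measure_display) (T : measurableType d)
    (P : probability T R)
    (H lambda_u p_a gamma Pt Gc alpha kappa a b : R)
    (X : nat -> {mfun T >-> (R * R)%type})
    (A L : nat -> set T)
    (h Theta : nat -> {mfun T >-> R})
    (x_k : R * R) (r_k s : R).
Hypotheses (pa01 : 0 <= p_a <= 1) (gamma02pi : 0 < gamma <= 2 * pi).
Hypotheses (Pt0 : 0 < Pt) (Gc0 : 0 < Gc) (a0 : 0 < a).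
Hypothesis PA : forall n, measurable (A n) /\ P (A n) = p_a%:E.
Hypothesis Ph : forall n, has_law P (h n) (exponential_prob 1).
Hypothesis PTheta : forall n, has_law P (Theta n) (uniform_prob (@two_pi_gt0 R)).
Hypothesis indep : mutually_independent P (source_events X A h Theta).
Hypothesis mL : forall n, measurable (L n).
Hypothesis LP : conditionally_bernoulli P (all_source_events X A h Theta) L
    (fun n w => los_prob a b (dist2 (X n w) x_k) H).
Hypotheses (rk0 : 0 <= r_k) (s0 : 0 <= s).

(** This is [s] times the power received at unit fading from a covering, line-of-sight UAV at ground
    distance [r]. *)
Let q (r : R) : R := s * Pt * Gc * link_distance H r `^ (- alpha)
  * expR (- (kappa * link_distance H r)).

Let q0 r : 0 <= q r.
Proof. by rewrite !mulr_ge0 ?powR_ge0 ?expR_ge0// ltW. Qed.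

Let measurable_link_distance : measurable_fun setT (link_distance H).
Proof.
apply: (measurableT_comp (f := @Num.sqrt R)).
  by apply: continuous_measurable_fun; exact: sqrt_continuous.
by apply: measurable_funD => //; exact: measurable_funX.
Qed.

Let mq : measurable_fun setT q.
Proof.
apply: measurable_funM.
  apply: measurable_funM => //.
  exact: (@measurableT_comp _ _ _ _ _ _ (fun x : R => x `^ (- alpha))).
apply: measurableT_comp => //; apply: measurable_funN.
exact: measurable_funM.
Qed.

Let pL (r : R) : R := los_prob a b r H.

Let pL01 r : 0 <= pL r <= 1.
Proof.
have e0 : 0 <= a * expR (- (b * (180 / pi * elevation H r - a))).
  by rewrite mulr_ge0 ?expR_ge0// ltW.
by rewrite /pL /los_prob invr_ge0 addr_ge0//= invf_le1 ?lerDl// ltr_pwDl.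
Qed.

Let mpL : measurable_fun setT pL.
Proof.
apply: (measurableT_comp (@measurable_invr R)).
apply: measurable_funD => //; apply: measurable_funM => //.
apply: measurableT_comp => //; apply: measurable_funN.
apply: measurable_funM => //; apply: measurable_funB => //.
apply: measurable_funM => //.
apply: measurable_fun_ifT => //.
  exact: (@measurable_fun_eqr _ _ _ _ id (cst 0)).
apply: (@measurableT_comp _ _ _ _ _ _ (@atan R)).
  by apply: continuous_measurable_fun => t; exact: continuous_atan.
by apply: measurable_funM => //; exact: measurable_invr.
Qed.

Let rho (y : R * R) : R := dist2 y x_k.

Let mrho : measurable_fun setT rho := measurable_dist2 x_k.

Let out (y : R * R) : R := \1_(~` disk x_k r_k) y.

Let outE y : out y = (r_k < rho y)%R%:R.
Proof.
rewrite /out indicE; congr (nat_of_bool _)%:R.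
by apply/idP/idP; rewrite inE /disk/= ltNge => /negP.
Qed.

Let mout : measurable_fun setT out.
Proof.
apply/measurable_indic/measurableC; rewrite -[disk _ _]setTI.
exact: measurable_fun_le.
Qed.

(* By [beam_coversP], the measurable form of the set of those (orientation,
   position) for which the vehicle is covered. *)
Let Cov : set (R * (R * R)) := [set z | dist2 x_k z.2 * cos (gamma / 2)
  <= (x_k.1 - z.2.1) * cos z.1 + (x_k.2 - z.2.2) * sin z.1].

Let mCov : measurable Cov.
Proof.
have mcos : measurable_fun setT (@cos R).
  by apply: continuous_measurable_fun; exact: continuous_cos.
have msin : measurable_fun setT (@sin R).
  by apply: continuous_measurable_fun; exact: continuous_sin.
have m1 : measurable_fun setT (fun z : R * (R * R) => z.2.1).
  exact: (measurableT_comp measurable_fst).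
have m2 : measurable_fun setT (fun z : R * (R * R) => z.2.2).
  exact: (measurableT_comp measurable_snd).
rewrite -[Cov]setTI; apply: measurable_fun_le => //.
  apply: measurable_funM => //.
  under eq_fun do rewrite dist2C.
  exact: (measurableT_comp mrho).
by apply: measurable_funD; apply: measurable_funM; try exact: measurable_funB;
  exact: measurableT_comp.
Qed.

Let cov (theta : R) (y : R * R) : R := \1_Cov (theta, y).

(* The fading is nonnegative only almost surely, so its negative part has to be
   cut off for [fad] to stay in [0, 1]. *)
Let fad (t : R) (y : R * R) : R := 1 - expR (- (q (rho y) * Num.max t 0)).

Let fad01 t y : 0 <= fad t y <= 1.
Proof.
rewrite /fad subr_ge0 gerBl expR_ge0 andbT -expR0 ler_expR oppr_le0.
by rewrite mulr_ge0// le_max lexx orbT.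
Qed.

Let ind01 U (B : set U) (x : U) : 0 <= (\1_B x : R) <= 1.
Proof. by rewrite indicE; case: (_ \in _); rewrite !lexx !ler01. Qed.

(** The space [T'] is arbitrary because the same expression is needed on [T], on [T] with the
    sigma-algebra of all sources, and on a product where positions and other sources are
    separated. *)
Let mfactor d' (T' : measurableType d') (a' h' t' : T' -> R) (x' : T' -> R * R) :
  measurable_fun setT a' -> measurable_fun setT h' ->
  measurable_fun setT t' -> measurable_fun setT x' ->
  measurable_fun setT
    (fun z => a' z * out (x' z) * cov (t' z) (x' z) * fad (h' z) (x' z)).
Proof.
move=> ma mh mt mx; apply: measurable_funM; last first.
  apply: measurable_funB => //; apply: measurableT_comp => //.
  apply: measurable_funN; apply: measurable_funM; last exact: measurable_maxr.
  by apply: (measurableT_comp mq); exact: measurableT_comp.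
apply: measurable_funM.
  by apply: measurable_funM => //; exact: measurableT_comp.
apply: (@measurableT_comp _ _ _ _ _ _ (\1_Cov : _ -> R) _ (fun z => (t' z, x' z))).
  exact: measurable_indic.
exact: measurable_fun_pair.
Qed.

Let act n w : R := \1_(A n) w.

(** The line-of-sight indicator is left out so that [Z n] is measurable for [all_source_events], the
    sigma-algebra of the conditioning. *)
Let Z n w : R :=
  act n w * out (X n w) * cov (Theta n w) (X n w) * fad (h n w) (X n w).

Let V n w : R := \1_(L n) w * Z n w.

Let v (y : R * R) : R :=
  p_a * (gamma / (2 * pi)) * (out y * pL (rho y) * (q (rho y) / (1 + q (rho y)))).

Let mul01 (u w : R) : 0 <= u <= 1 -> 0 <= w <= 1 -> 0 <= u * w <= 1.
Proof. by move=> /andP[? ?] /andP[? ?]; rewrite mulr_ge0// mulr_ile1. Qed.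

Let Z01 n w : 0 <= Z n w <= 1.
Proof.
rewrite /Z; apply: mul01 => //; apply: mul01; last exact: ind01.
by apply: mul01; exact: ind01.
Qed.

Let V01 n w : 0 <= V n w <= 1.
Proof. by apply: mul01 => //; exact: ind01. Qed.

Let q1 r : 0 <= q r / (1 + q r) < 1.
Proof.
have q10 : 0 < 1 + q r by rewrite ltr_pwDl.
by rewrite divr_ge0// ?(ltW q10)// ltr_pdivrMr// mul1r ltrDr ltr01.
Qed.

(** The strict bound, inherited from [q / (1 + q) < 1], makes [1 - v y] positive and its logarithm
    meaningful. *)
Let v01 y : 0 <= v y < 1.
Proof.
have /andP[qq0 qq1] := q1 (rho y).
have g01 : 0 <= gamma / (2 * pi) <= 1.
  case/andP: gamma02pi => g0 g2; have p0 := @two_pi_gt0 R.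
  by rewrite divr_ge0 ?(ltW g0) ?(ltW p0)//= ler_pdivrMr// mul1r.
have : 0 <= p_a * (gamma / (2 * pi)) * (out y * pL (rho y)) <= 1.
  by apply: mul01; apply: mul01 => //; exact: ind01.
rewrite /v (mulrA _ (out y * _)) => /andP[c0 c1].
rewrite mulr_ge0//=; apply: le_lt_trans qq1.
by rewrite ler_piMl.
Qed.

Let mv : measurable_fun setT v.
Proof.
have mqr : measurable_fun setT (fun y => q (rho y)) by exact: measurableT_comp.
apply: measurable_funM => //; apply: measurable_funM.
  by apply: measurable_funM => //; exact: measurableT_comp.
apply: measurable_funM => //; apply: (measurableT_comp (@measurable_invr R)).
exact: measurable_funD.
Qed.

Let mact n : measurable_fun setT (act n).
Proof. by apply: measurable_indic; have [] := PA n. Qed.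

Let mZ n : measurable_fun setT (Z n).
Proof. exact: mfactor. Qed.

Let mV n : measurable_fun setT (V n).
Proof. by apply: measurable_funM => //; exact: measurable_indic. Qed.

Local Notation S := (source_events X A h Theta).

Let Sm i : S i `<=` measurable.
Proof.
have mfunP d' (T' : measurableType d') (Y : {mfun T >-> T'}) :
    generated_by Y `<=` measurable by move=> _ [B mB <-]; exact: measurable_funP.
case: i => [|n|n|n] /=; try exact: mfunP.
- apply: smallest_sub; first exact: sigma_algebra_measurable.
  by move=> B [n _]; exact: mfunP.
- apply: smallest_sub; first exact: sigma_algebra_measurable.
  by move=> B ->; have [] := PA n.
Qed.

Let Ss i : sigma_algebra setT (S i).
Proof.
case: i => [|n|n|n] /=; try exact: smallest_sigma_algebra;
  by apply: sigma_algebra_preimage; exact: sigma_algebra_measurable.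
Qed.

Let mXC (C : set_system T) n : S Positions `<=` <<s C >> ->
  measurable_fun setT (X n : g_sigma_algebraType C -> R * R).
Proof.
move=> SC; apply: measurable_fun_generated_by => B XB; apply: SC.
by apply: sub_sigma_algebra; exists n.
Qed.

Let mactC (C : set_system T) n : S (Activation n) `<=` <<s C >> ->
  measurable_fun setT (act n : g_sigma_algebraType C -> R).
Proof.
move=> SC; apply: measurable_indic; apply: SC.
exact: sub_sigma_algebra.
Qed.

Let mhC (C : set_system T) n : S (Fading n) `<=` <<s C >> ->
  measurable_fun setT (h n : g_sigma_algebraType C -> R).
Proof. exact: measurable_fun_generated_by. Qed.

Let mThetaC (C : set_system T) n : S (Orientation n) `<=` <<s C >> ->
  measurable_fun setT (Theta n : g_sigma_algebraType C -> R).
Proof. exact: measurable_fun_generated_by. Qed.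

Let mfadt y : measurable_fun setT (fad^~ y).
Proof.
apply: measurable_funB => //; apply: measurableT_comp => //.
apply: measurable_funN; apply: measurable_funM => //.
exact: measurable_maxr.
Qed.

Let mcovt y : measurable_fun setT (cov^~ y).
Proof.
apply: (@measurableT_comp _ _ _ _ _ _ (\1_Cov : _ -> R) _ (fun t => (t, y))).
  exact: measurable_indic.
by apply: measurable_fun_pair.
Qed.

Let integral_act n : (\int[P]_w (act n w)%:E = p_a%:E)%E.
Proof. by have [mA PAn] := PA n; rewrite integral_indic// setIT. Qed.

Let integral_fad n y :
  (\int[P]_w (fad (h n w) y)%:E = (q (rho y) / (1 + q (rho y)))%:E)%E.
Proof.
rewrite -(@integral_exponential_onem R (distribution P (h n)))//; last exact: Ph.
rewrite ge0_integral_pushforward//=.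
- by apply/measurable_EFinP; exact: (mfadt y).
- by move=> t _; rewrite lee_fin; case/andP: (fad01 t y).
Qed.

(* A UAV right above the vehicle always covers it; this value does not matter in
   the end because [out x_k = 0]. *)
Let cov_mean y : R := if y == x_k then 1 else gamma / (2 * pi).

Let integral_cov n y : (\int[P]_w (cov (Theta n w) y)%:E = (cov_mean y)%:E)%E.
Proof.
have CovE t : Cov (t, y) <-> beam_covers gamma t y x_k.
  exact: iff_sym (beam_coversP _ _ _ gamma02pi).
rewrite /cov_mean; have [->|yx] := eqVneq y x_k.
  rewrite (eq_integral (cst 1%:E)); last first.
    move=> w _; rewrite /cov indicE mem_set// /Cov/=.
    rewrite (_ : dist2 x_k x_k = 0) ?mul0r ?subrr ?mul0r ?addr0//.
    by apply/eqP; rewrite dist2_eq0.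
  by rewrite integral_cst//= mul1e probability_setT.
have mB : measurable [set t | Cov (t, y)].
  rewrite -[X in measurable X]setTI.
  exact: (@measurable_fun_pair _ _ _ _ _ _ id (cst y)).
rewrite -(uniform_prob_beam_covers gamma02pi (x := x_k) (y := y)); last first.
  by rewrite eq_sym.
transitivity (distribution P (Theta n) [set t | Cov (t, y)]).
  pose B := Theta n @^-1` [set t | Cov (t, y)].
  have mTB : measurable B by exact: measurable_funPTI.
  transitivity (\int[P]_w (\1_B w)%:E)%E; last by rewrite integral_indic// setIT.
  apply: eq_integral => w _; rewrite /cov !indicE.
  by have -> : (w \in B) = ((Theta n w, y) \in Cov) by apply/idP/idP; rewrite !inE.
rewrite PTheta//; congr uniform_prob; apply/seteqP.
by split => t /= /CovE.
Qed.

Let integral_prod_Z (J : seq nat) : uniq J ->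
  (\int[P]_w (\prod_(n <- J) Z n w * \prod_(n <- J) pL (rho (X n w)))%:E
   = \int[P]_w (\prod_(n <- J) v (X n w))%:E)%E.
Proof.
move=> uJ.
(* Positions are read at [w], all other sources at [w']. *)
pose Zf w w' n :=
  act n w' * out (X n w) * cov (Theta n w') (X n w) * fad (h n w') (X n w).
pose f w w' : \bar R :=
  (\prod_(n <- J) Zf w w' n * \prod_(n <- J) pL (rho (X n w)))%:E.
have Zf0 w w' n : 0 <= Zf w w' n.
  have : 0 <= Zf w w' n <= 1; last by case/andP.
  rewrite /Zf; apply: mul01 => //; apply: mul01; last exact: ind01.
  by apply: mul01; exact: ind01.
have pL0 r : 0 <= pL r by case/andP: (pL01 r).
have PS : S Positions `<=` <<s S Positions >> by exact: sub_sigma_algebra.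
rewrite (@integral_independent_others _ _ _ _ _ _ Sm Ss indep Positions f); last 2 first.
- apply/measurable_EFinP; apply: measurable_funM; apply: measurable_prod => n _.
    have oS i : i <> Positions ->
        S i `<=` <<s \bigcup_(i in [set i | i != Positions]) S i >>.
      by move=> /eqP iP B SB; apply: sub_sigma_algebra; exists i.
    apply: (@mfactor _ (g_sigma_algebraType (S Positions) *
      g_sigma_algebraType (\bigcup_(i in [set i | i != Positions]) S i))%type
      (fun z => act n z.2) (fun z => h n z.2) (fun z => Theta n z.2) (fun z => X n z.1)).
    - exact: (measurableT_comp (mactC (oS (Activation n) _)) measurable_snd).
    - exact: (measurableT_comp (mhC (oS (Fading n) _)) measurable_snd).
    - exact: (measurableT_comp (mThetaC (oS (Orientation n) _)) measurable_snd).
    - exact: (measurableT_comp (mXC n PS) measurable_fst).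
  apply: (measurableT_comp mpL); apply: (measurableT_comp mrho).
  exact: (measurableT_comp (mXC n PS) measurable_fst).
- by move=> w w'; rewrite lee_fin mulr_ge0// prodr_ge0.
apply: eq_integral => w _.
(* One random factor per source, for positions frozen at [w]; the value at [Positions] is a
   placeholder, absent from [J']. *)
pose Y i w' : R := match i with
  | Positions => 1
  | Activation n => act n w'
  | Fading n => fad (h n w') (X n w)
  | Orientation n => cov (Theta n w') (X n w)
  end.
pose m i : R := match i with
  | Positions => 1
  | Activation n => p_a
  | Fading n => q (rho (X n w)) / (1 + q (rho (X n w)))
  | Orientation n => cov_mean (X n w)
  end.
pose J' := map Activation J ++ map Orientation J ++ map Fading J.
have uJ' : uniq J'.
  have injA : injective Activation by move=> ? ? [].
  have injO : injective Orientation by move=> ? ? [].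
  have injF : injective Fading by move=> ? ? [].
  have disj (f1 f2 : nat -> source) : (forall n n', f1 n <> f2 n') ->
      ~~ has (mem (map f1 J)) (map f2 J).
    move=> f12; apply/hasPn => _ /mapP[n _ ->].
    by apply/negP => /mapP[n' _] /esym; exact: f12.
  by rewrite !cat_uniq !map_inj_uniq// uJ has_cat negb_or !disj.
pose c := \prod_(n <- J) (out (X n w) * pL (rho (X n w))).
have c0 : 0 <= c.
  by apply: prodr_ge0 => n _; rewrite mulr_ge0.
have Y0 i w' : 0 <= Y i w'.
  by case: i => [|n|n|n] //=; case/andP: (fad01 (h n w') (X n w)).
have prodJ' (u : source -> R) : \prod_(i <- J') u i
    = \prod_(n <- J) (u (Activation n) * u (Orientation n) * u (Fading n)).
  by rewrite /J' !big_cat/= !big_map !big_split/= mulrA.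
transitivity (\int[P]_w' (c%:E * (\prod_(i <- J') Y i w')%:E))%E.
  apply: eq_integral => w' _; rewrite -EFinM /f prodJ' /c -!big_split/=.
  by congr EFin; apply: eq_bigr => n _; rewrite /Zf; ring.
have mY i : measurable_fun setT (Y i : g_sigma_algebraType (S i) -> R).
  have SS : S i `<=` <<s S i >> by exact: sub_sigma_algebra.
  case: i SS => [|n|n|n] SS.
  - exact: measurable_cst.
  - exact: mactC.
  - exact: (measurableT_comp (mfadt _) (mhC SS)).
  - exact: (measurableT_comp (mcovt _) (mThetaC SS)).
rewrite ge0_integralZl//; last 2 first.
- apply/measurable_EFinP; apply: measurable_prod => i _.
  exact: (measurable_fun_from_sub_sigma_algebra (@Sm i) (mY i)).
- by move=> w' _; rewrite lee_fin prodr_ge0.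
rewrite (integral_prod_independent Sm Ss indep)//.
rewrite (eq_bigr (fun i => (m i)%:E)); last first.
  by case=> [|n|n|n] _ /=; [rewrite integral_cst//= mul1e probability_setT
    |exact: integral_act|exact: integral_fad|exact: integral_cov].
rewrite prodEFin -EFinM prodJ' /c -big_split/=; congr EFin; apply: eq_bigr => n _.
(* At [x_k] the distance 0 does not exceed [r_k], so [out] annihilates both sides. *)
rewrite /v /cov_mean; case: eqP => [->|_]; last by ring.
rewrite outE /rho (_ : dist2 x_k x_k = 0); last by apply/eqP; rewrite dist2_eq0.
by rewrite ltNge rk0 /=; ring.
Qed.

Let integral_prod_V (J : seq nat) : uniq J ->
  (\int[P]_w (\prod_(n <- J) V n w)%:E
   = \int[P]_w (\prod_(n <- J) v (X n w))%:E)%E.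
Proof.
move=> uJ; rewrite -integral_prod_Z//.
have Gs : sigma_algebra setT (all_source_events X A h Theta).
  exact: smallest_sigma_algebra.
have Gm : all_source_events X A h Theta `<=` measurable.
  apply: smallest_sub; first exact: sigma_algebra_measurable.
  by move=> B [i _]; exact: Sm.
have SG i : S i `<=` <<s all_source_events X A h Theta >>.
  move=> B SB; apply: sub_sigma_algebra; apply: sub_sigma_algebra.
  by exists i.
rewrite -(integral_conditionally_bernoulli Gm Gs mL _ _ LP uJ)//.
- apply: eq_integral => w _; congr EFin.
  by rewrite mulrC -big_split.
- by move=> n; apply: (measurableT_comp mpL); exact: (measurableT_comp mrho).
- by move=> n w; case/andP: (pL01 (rho (X n w))).
- apply: measurable_prod => n _.
  exact: (@mfactor _ (g_sigma_algebraType (all_source_events X A h Theta))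
    (act n) (h n) (Theta n) (X n) (mactC (SG _)) (mhC (SG _)) (mThetaC (SG _))
    (mXC n (SG _))).
- by move=> w; apply: prodr_ge0 => n _; case/andP: (Z01 n w).
Qed.

Let integral_prod_onemV N :
  (\int[P]_w (\prod_(0 <= n < N) (1 - V n w))%:E
   = \int[P]_w (\prod_(0 <= n < N) (1 - v (X n w)))%:E)%E.
Proof.
apply: (integral_prod_onem mV _ V01 (v := fun n w => v (X n w)) _ integral_prod_V).
- by move=> n; exact: (measurableT_comp mv).
- by move=> n w; case/andP: (v01 (X n w)) => -> /ltW.
- exact: iota_uniq.
Qed.

(** The n-th term of [s * I], with the fading cut off at 0. *)
Let gV n w : R := \1_(L n) w * (act n w * out (X n w) * cov (Theta n w) (X n w))
  * (q (rho (X n w)) * Num.max (h n w) 0).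

Let expR_gV n w : expR (- gV n w) = 1 - V n w.
Proof.
rewrite /gV /V /Z /fad /act /out /cov !indicE.
case: (_ \in _); case: (_ \in _); case: (_ \in _); case: (_ \in _);
  by rewrite ?(mul0r, mul1r, mulr0, mulr1, oppr0, expR0, subr0, subKr).
Qed.

Let gV0 n w : 0 <= gV n w.
Proof.
have m0 : 0 <= Num.max (h n w) 0 by rewrite le_max lexx orbT.
have i0 U (B : set U) x : 0 <= (\1_B x : R) by case/andP: (ind01 B x).
by do ![apply: mulr_ge0 => //]; exact: i0.
Qed.

Let mgV n : measurable_fun setT (gV n).
Proof.
rewrite (_ : gV n = (fun w => - ln (1 - V n w))).
  apply: measurable_funN; apply: measurableT_comp => //.
  exact: measurable_funB.
by apply/funext => w; rewrite -expR_gV expRK opprK.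
Qed.

(** The test function for which the Laplace functional integrates [1 - expR (- fv y) = v y]. *)
Let fv (y : R * R) : R := - ln (1 - v y).

Let expR_fv y : expR (- fv y) = 1 - v y.
Proof. by rewrite opprK lnK// posrE subr_gt0; case/andP: (v01 y). Qed.

Let fv0 y : 0 <= fv y.
Proof.
rewrite oppr_ge0 -ler_expR expR0 lnK ?gerBl; first by case/andP: (v01 y).
by rewrite posrE subr_gt0; case/andP: (v01 y).
Qed.

Let mfv : measurable_fun setT fv.
Proof.
apply: measurable_funN; apply: measurableT_comp => //.
exact: measurable_funB.
Qed.

Let integral_expeR_gV : (\int[P]_w expeR (- \sum_(n <oo) (gV n w)%:E)
  = \int[P]_w expeR (- \sum_(n <oo) (fv (X n w))%:E))%E.
Proof.
have cV := cvg_integral_prod_expR mgV gV0 (P := P).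
have cv := @cvg_integral_prod_expR _ _ _ P (fun n w => fv (X n w))
  (fun n => measurableT_comp mfv (measurable_funP (X n))) (fun n w => fv0 (X n w)).
have E N : (\int[P]_w (\prod_(0 <= n < N) expR (- gV n w))%:E
    = \int[P]_w (\prod_(0 <= n < N) expR (- fv (X n w)))%:E)%E.
  transitivity (\int[P]_w (\prod_(0 <= n < N) (1 - V n w))%:E)%E.
    by apply: eq_integral => w _; congr EFin; apply: eq_bigr => n _; rewrite expR_gV.
  rewrite integral_prod_onemV; apply: eq_integral => w _; congr EFin.
  by apply: eq_bigr => n _; rewrite expR_fv.
move: cV; rewrite (funext E) => cV.
exact: (cvg_unique (@ereal_hausdorff R) cV cv).
Qed.

Let interferenceE w : (forall n, 0 <= h n w) ->
  (s%:E * interference X A h Theta H Pt Gc gamma alpha kappa L x_k r_k w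
   = \sum_(n <oo) (gV n w)%:E)%E.
Proof.
move=> h0.
have gainE n : gain X Theta Gc gamma x_k n w = Gc * cov (Theta n w) (X n w).
  rewrite /gain /cov indicE.
  have -> : `[< beam_covers gamma (Theta n w) (X n w) x_k >]
      = ((Theta n w, X n w) \in Cov).
    by apply/asboolP/idP; rewrite inE => /(beam_coversP _ _ _ gamma02pi).
  by case: (_ \in _); rewrite ?mulr1 ?mulr0.
have rp0 n : 0 <= received_power X h Theta H Pt Gc gamma alpha kappa L x_k n w.
  rewrite /received_power gainE.
  by rewrite !mulr_ge0 ?powR_ge0 ?expR_ge0// ?(ltW Pt0) ?(ltW Gc0).
(* Nonnegativity of the powers turns the sum over a random index set into a series, with membership
   in that set as 0-1 factors. *)
rewrite /interference esum_mkcond -nneseries_esumT; last first.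
  by move=> n; case: ifP => // _; rewrite lee_fin.
rewrite -nneseriesZl; last by move=> n _; case: ifP => // _; rewrite lee_fin.
apply: eq_eseriesr => n _.
have -> : (n \in [set n | A n w /\ (~` disk x_k r_k) (X n w)])
    = (w \in A n) && (X n w \in ~` disk x_k r_k).
  by apply/idP/andP; rewrite !inE.
rewrite /gV /act /out !indicE max_l// /received_power gainE.
case: (w \in A n); case: (X n w \in _) => /=;
  rewrite ?(mul0r, mulr0, mule0, mul1r, mulr1) -?EFinM//; congr EFin.
by rewrite /q /rho indicE; ring.
Qed.

Let laplace_interference_gV :
  laplace_transform P (interference X A h Theta H Pt Gc gamma alpha kappa L x_k r_k) s
  = (\int[P]_w expeR (- \sum_(n <oo) (gV n w)%:E))%E.
Proof.
have hN n : P (h n @^-1` `]-oo, 0%R[%classic) = 0%E.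
  apply: (etrans (Ph n (measurable_itv `]-oo, 0[))).
  apply: integral0_eq => t; rewrite /= in_itv/= => t0.
  by rewrite lt0_exponential_pdf.
have mhN n : measurable (h n @^-1` `]-oo, 0%R[%classic).
  exact: measurable_funPTI.
(* The event that some fading is negative, null by countable subadditivity; off it the cut-off in
   [gV] does nothing. *)
pose N := \bigcup_n (h n @^-1` `]-oo, 0%R[%classic).
apply: (@ge0_integral_eq_off_null _ _ _ P _ _ N).
- by move=> w; exact: expeR_ge0.
- by move=> w; exact: expeR_ge0.
- exact: bigcupT_measurable.
- apply/eqP; rewrite eq_le measure_ge0 andbT.
  have := generalized_Boole_inequality P mhN (bigcupT_measurable _ mhN).
  by rewrite eseries0// => n _ _; exact: hN.
move=> w Nw; rewrite interferenceE// => n; rewrite leNgt; apply/negP => hn.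
by apply: Nw; exists n => //=; rewrite in_itv.
Qed.

Let integral_v : (\int[area]_y (v y)%:E = (gamma * p_a)%:E *
  \int[@lebesgue_measure R]_(x in `[r_k, +oo[)
    (q x / (1 + q x) * los_prob a b x H * x)%:E)%E.
Proof.
(* The radial profile of [v]. It vanishes at [t = r_k] since the excluded disk is closed, so the
   half-line of the target is opened at [r_k] below. *)
pose phi (t : R) : R := p_a * (gamma / (2 * pi)) *
  ((r_k < t)%R%:R * pL t * (q t / (1 + q t))).
have phi0 t : 0 <= phi t.
  have /andP[? _] := pa01; have /andP[/ltW ? _] := gamma02pi.
  have /andP[? _] := pL01 t; have /andP[? _] := q1 t.
  have ? : 0 <= gamma / (2 * pi) by rewrite divr_ge0// (ltW (@two_pi_gt0 R)).
  by apply: mulr_ge0; apply: mulr_ge0 => //; apply: mulr_ge0.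
have mpsi : measurable_fun setT (fun t => q t / (1 + q t) * pL t * t).
  apply: measurable_funM => //; apply: measurable_funM => //.
  apply: measurable_funM => //; apply: (measurableT_comp (@measurable_invr R)).
  exact: measurable_funD.
have mphi : measurable_fun setT (EFin \o phi).
  apply/measurable_EFinP; apply: measurable_funM => //; apply: measurable_funM.
    apply: measurable_funM => //.
    rewrite (_ : (fun t => _) = \1_(`]r_k, +oo[%classic)).
      by apply: measurable_indic; exact: measurable_itv.
    apply/funext => t; rewrite indicE; congr (nat_of_bool _)%:R.
    by apply/idP/idP; rewrite inE/= in_itv/= andbT.
  apply: measurable_funM => //; apply: (measurableT_comp (@measurable_invr R)).
  exact: measurable_funD.
transitivity (\int[area]_y (phi (dist2 y x_k))%:E)%E.
  by apply: eq_integral => y _; rewrite /v outE.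
rewrite (integral_radial x_k mphi); last by move=> t; rewrite lee_fin.
rewrite -integral_itv_obnd_cbnd; last exact/measurable_EFinP/measurable_funTS.
rewrite -ge0_integralZl//; last 3 first.
- exact/measurable_EFinP/measurable_funTS.
- move=> t; rewrite /= in_itv/= andbT => /ltW rt; rewrite lee_fin.
  have /andP[? _] := pL01 t; have /andP[? _] := q1 t.
  by apply: mulr_ge0; [exact: mulr_ge0|exact: le_trans rt].
- have /andP[? _] := pa01; have /andP[/ltW ? _] := gamma02pi.
  by rewrite lee_fin mulr_ge0.
rewrite [LHS]integral_mkcond [RHS]integral_mkcond; apply: eq_integral => t _.
rewrite !patchE.
have -> : (t \in `[0%R, +oo[%classic) = (0 <= t).
  by apply/idP/idP; rewrite inE/= in_itv/= andbT.
have -> : (t \in `]r_k, +oo[%classic) = (r_k < t).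
  by apply/idP/idP; rewrite inE/= in_itv/= andbT.
rewrite /= /phi; have [rt|tr] := ltP r_k t; last first.
  by case: ifP => // _; rewrite !(mul0r, mulr0) mul0e.
rewrite (le_trans rk0 (ltW rt)) -!EFinM mul1r; congr EFin.
rewrite -/(pL t); move: (q t / (1 + q t)) (pL t) => u l.
have : pi != 0 :> R by rewrite gt_eqF// pi_gt0.
by move: (@pi R) => p p0; field.
Qed.

Lemma laplace_transform_interference : 0 <= lambda_u ->
  homogeneous_poisson_process P lambda_u X ->
  laplace_transform P
    (interference X A h Theta H Pt Gc gamma alpha kappa L x_k r_k) s
  = expeR (- ((gamma * lambda_u * p_a)%:E *
      \int[@lebesgue_measure R]_(x in `[r_k, +oo[)
        (q x / (1 + q x) * los_prob a b x H * x)%:E))%E.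
Proof.
move=> lambda0 PX.
rewrite laplace_interference_gV integral_expeR_gV.
rewrite (laplace_poisson lambda0 PX mfv fv0).
under eq_integral do rewrite expR_fv subKr.
by rewrite integral_v muleA -EFinM mulrCA mulrA.
Qed.

End interference.

Theorem theorem4 (R : realType) (d : measure_display) (T : measurableType d)
    (P : probability T R)
    (H lambda_u p_a gamma Pt Gc alpha kappa a b : R)
    (X : nat -> {mfun T >-> (R * R)%type})
    (A L : nat -> set T)
    (h Theta : nat -> {mfun T >-> R})
    (x_k : R * R) (r_k s : R) :
  0 < H -> 0 < lambda_u -> 0 <= p_a <= 1 -> 0 < gamma <= 2 * pi ->
  0 < Pt -> 0 < Gc -> 0 < alpha -> 0 < kappa -> 0 < a -> 0 < b ->
  homogeneous_poisson_process P lambda_u X ->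
  (forall n, measurable (A n) /\ P (A n) = p_a%:E) ->
  (forall n, has_law P (h n) (exponential_prob 1)) ->
  (forall n, has_law P (Theta n) (uniform_prob (@two_pi_gt0 R))) ->
  mutually_independent P (source_events X A h Theta) ->
  (forall n, measurable (L n)) ->
  conditionally_bernoulli P (all_source_events X A h Theta) L
    (fun n w => los_prob a b (dist2 (X n w) x_k) H) ->
  0 <= r_k -> 0 <= s ->
  laplace_transform P
    (interference X A h Theta H Pt Gc gamma alpha kappa L x_k r_k) s
  = expeR (- ((gamma * lambda_u * p_a)%:E *
      \int[@lebesgue_measure R]_(x in `[r_k, +oo[)
        (let q := s * Pt * Gc * link_distance H x `^ (- alpha)
                  * expR (- (kappa * link_distance H x)) in
         q / (1 + q) * los_prob a b x H * x)%:E))%E.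
Proof.
move=> _ /ltW lambda0 pa01 gamma02pi Pt0 Gc0 _ _ a0 _ PX PA Ph PTheta indep mL LP.
move=> rk0 s0.
exact: (laplace_transform_interference alpha kappa pa01 gamma02pi Pt0 Gc0 a0 PA
  Ph PTheta indep mL LP rk0 s0 lambda0 PX).
Qed.
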